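(* Let $p$ be a prime and $n\ge1$. The mod $p$ cohomology Lyndon–Hochschild–Serre spectral sequence $$E_2^{s,t}=H^s\Bigl(\mathrm{Aut}\bigl(\textstyle\bigoplus_n\mathbb{Z}_{p^r}\bigr);H^t\bigl(\textstyle\bigoplus_n\mathbb{Z}_{p^r};\mathbb{F}_p\bigr)\Bigr)\Rightarrow H^{s+t}\Bigl(\mathrm{Hol}\bigl(\textstyle\bigoplus_n\mathbb{Z}_{p^r}\bigr);\mathbb{F}_p\Bigr)$$ of the extension $$1\to\textstyle\bigoplus_n\mathbb{Z}_{p^r}\to\mathrm{Hol}\bigl(\bigoplus_n\mathbb{Z}_{p^r}\bigr)\to\mathrm{Aut}\bigl(\bigoplus_n\mathbb{Z}_{p^r}\bigr)\to1$$ does not collapse at the $E_2$ stage if $p=2$ and $r\ge3$, or $p$ is odd and $r\ge2$.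
   Context: $\bigoplus_n\mathbb{Z}_{p^r}$ is the direct sum of $n$ copies of the cyclic group of order $p^r$; its automorphism group is $GL(n,\mathbb{Z}_{p^r})$. For a group $K$, the holomorph $\mathrm{Hol}(K)$ is the group of pairs $(f,x)$, $f\in\mathrm{Aut}(K)$, $x\in K$, with multiplication $(f,x)(g,y)=(fg,g^{-1}(x)y)$, with $K\to\mathrm{Hol}(K)$, $x\mapsto(1,x)$ and $\mathrm{Hol}(K)\to\mathrm{Aut}(K)$, $(f,x)\mapsto f$. ''Collapses at the $E_2$ stage'' means that all differentials $d_k$ with $k\ge2$ vanish. *)

(* Defs.v *)
From HB Require Import structures.
From mathcomp Require Import all_boot all_order all_algebra all_fingroup.
From mathcomp Require Import zify.

Set Implicit Arguments.
Unset Strict Implicit.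
Unset Printing Implicit Defensive.

Import GRing.Theory.

Local Open Scope group_scope.

(* [Aut [set: K]] of the library multiplies diagrammatically,
   (f * g) x = g (f x).  The formula defining the holomorph below is for the
   product f \o g, hence this separate type with the composition order. *)
Definition autG (K : finGroupType) : Type := {f : {perm K} | f \in Aut [set: K]}.

HB.instance Definition _ (K : finGroupType) := [Finite of autG K by <:].

Section AutG.
Variable K : finGroupType.

Definition aut_fun (f : autG K) : K -> K := val f.

Definition aut_mul (f g : autG K) : autG K :=
  exist _ (val g * val f) (groupM (valP g) (valP f)).
Definition aut_one : autG K := exist _ 1 (group1 (Aut [set: K])).
Definition aut_inv (f : autG K) : autG K :=
  exist _ (val f)^-1 (groupVr (valP f)).

Fact aut_mulA : associative aut_mul.
Proof. by move=> f g h; apply: val_inj; rewrite /= mulgA. Qed.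
Fact aut_mul1 : left_id aut_one aut_mul.
Proof. by move=> f; apply: val_inj; rewrite /= mulg1. Qed.
Fact aut_mulV : left_inverse aut_one aut_inv aut_mul.
Proof. by move=> f; apply: val_inj; rewrite /= mulgV. Qed.

HB.instance Definition _ :=
  Finite_isGroup.Build (autG K) aut_mulA aut_mul1 aut_mulV.

Lemma aut_funM (f g : autG K) x : aut_fun (f * g) x = aut_fun f (aut_fun g x).
Proof. by rewrite /aut_fun permM. Qed.

Lemma aut_fun1 x : aut_fun 1 x = x.
Proof. by rewrite /aut_fun perm1. Qed.

Lemma aut_fun_morph (f : autG K) x y :
  aut_fun f (x * y) = aut_fun f x * aut_fun f y.
Proof. by have /morphicP := Aut_morphic (valP f); apply; rewrite inE. Qed.

Lemma aut_fun_id (f : autG K) : aut_fun f 1 = 1.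
Proof. by apply: (mulgI (aut_fun f 1)); rewrite -aut_fun_morph !mulg1. Qed.

End AutG.

Record Hol (K : finGroupType) := MkHol { hol_aut : autG K; hol_elt : K }.

Section HolType.
Variable K : finGroupType.
Definition pair_of_hol (u : Hol K) := (hol_aut u, hol_elt u).
Definition hol_of_pair u : Hol K := MkHol u.1 u.2.
Fact pair_of_holK : cancel pair_of_hol hol_of_pair.
Proof. by case. Qed.
End HolType.

HB.instance Definition _ (K : finGroupType) :=
  Finite.copy (Hol K) (can_type (@pair_of_holK K)).

Section HolGroup.
Variable K : finGroupType.

Definition hol_mul (u v : Hol K) : Hol K :=
  MkHol (hol_aut u * hol_aut v)
        (aut_fun (hol_aut v)^-1 (hol_elt u) * hol_elt v).
Definition hol_one : Hol K := MkHol 1 1.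
Definition hol_inv (u : Hol K) : Hol K :=
  MkHol (hol_aut u)^-1 (aut_fun (hol_aut u) (hol_elt u)^-1).

Fact hol_mulA : associative hol_mul.
Proof.
move=> [f x] [g y] [h z]; rewrite /hol_mul /=; congr MkHol; first exact: mulgA.
by rewrite aut_fun_morph invMg aut_funM mulgA.
Qed.

Fact hol_mul1 : left_id hol_one hol_mul.
Proof. by case=> f x; rewrite /hol_mul /= aut_fun_id !mul1g. Qed.

Fact hol_mulV : left_inverse hol_one hol_inv hol_mul.
Proof.
case=> f x; rewrite /hol_mul /hol_one /= mulVg; congr MkHol.
by rewrite -aut_funM mulVg aut_fun1 mulVg.
Qed.

HB.instance Definition _ :=
  Finite_isGroup.Build (Hol K) hol_mulA hol_mul1 hol_mulV.

End HolGroup.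

Record extension (N G Q : finGroupType) := Extension {
  ext_in : N -> G;
  ext_pr : G -> Q;
  ext_inM : {morph ext_in : x y / x * y};
  ext_prM : {morph ext_pr : x y / x * y};
  ext_in_inj : injective ext_in;
  ext_pr_surj : forall q, exists g, ext_pr g = q;
  ext_exact : forall g, ext_pr g = 1 <-> exists x, ext_in x = g
}.

Section HolExtension.
Variable K : finGroupType.

Definition hol_in (x : K) : Hol K := MkHol 1 x.

Fact hol_inM : {morph hol_in : x y / x * y}.
Proof.
move=> x y; rewrite /hol_in; apply: esym.
by rewrite [LHS]/(hol_mul _ _) /hol_mul /= mulg1 invg1 aut_fun1.
Qed.

Fact hol_autM : {morph @hol_aut K : u v / u * v}.
Proof. by []. Qed.

Fact hol_in_inj : injective hol_in.
Proof. by move=> x y []. Qed.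

Fact hol_aut_surj q : exists u, @hol_aut K u = q.
Proof. by exists (MkHol q 1). Qed.

Fact hol_exact u : hol_aut u = 1 <-> exists x, hol_in x = u.
Proof. by case: u => f x; split=> [/= -> | [y [<- _]] //]; exists x. Qed.

Definition hol_extension : extension K (Hol K) (autG K) :=
  Extension hol_inM hol_autM hol_in_inj hol_aut_surj hol_exact.

End HolExtension.

Local Open Scope ring_scope.

Definition simplex (T : finType) (s : nat) := {ffun 'I_s.+1 -> T}.

Definition face (T : finType) s (i : 'I_s.+2) (x : simplex T s.+1) :
  simplex T s := [ffun j => x (lift i j)].

Definition shift (gT : finGroupType) s (g : gT) (x : simplex gT s) :
  simplex gT s := [ffun j => (g * x j)%g].

Lemma face_shift (gT : finGroupType) s (g : gT) i (x : simplex gT s.+1) :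
  face i (shift g x) = shift g (face i x).
Proof. by apply/ffunP=> j; rewrite !ffunE. Qed.

Lemma face_face (T : finType) s (x : simplex T s.+2) (i : 'I_s.+3)
    (j : 'I_s.+2) (i' : 'I_s.+2) (j' : 'I_s.+3) :
  (j < i)%N -> i = i'.+1 :> nat -> j = j' :> nat ->
  face j (face i x) = face i' (face j' x).
Proof.
move=> ji Ei Ej; apply/ffunP=> k; rewrite !ffunE; congr (x _); apply: val_inj.
rewrite /= -Ej Ei /bump; move: ji; rewrite Ei ltnS => ji.
by case: (leqP j k); case: (leqP i' k); case: leqP; case: leqP; lia.
Qed.

Lemma sum_face_face (R : pzRingType) (T : finType) s (x : simplex T s.+2)
    (f : simplex T s -> R) :
  \sum_(i < s.+3) \sum_(j < s.+2) (-1) ^+ (i + j) * f (face j (face i x)) = 0.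
Proof.
rewrite pair_bigA /= (bigID (fun p : 'I_s.+3 * 'I_s.+2 => p.2 < p.1)%N) /=.
pose h (p : 'I_s.+3 * 'I_s.+2) : 'I_s.+3 * 'I_s.+2 :=
  (inord p.2, inord p.1.-1).
pose g (p : 'I_s.+3 * 'I_s.+2) : 'I_s.+3 * 'I_s.+2 :=
  (inord p.2.+1, inord p.1).
have g1 i j : val (g (i, j)).1 = j.+1 by rewrite /= inordK // ltnS.
have g2 (i : 'I_s.+3) (j : 'I_s.+2) : (i <= j)%N -> val (g (i, j)).2 = i.
  by move=> ij; rewrite /= inordK // (leq_ltn_trans ij).
have h1 i j : val (h (i, j)).1 = j by rewrite /= inordK // ltnS ltnW.
have h2 (i : 'I_s.+3) (j : 'I_s.+2) : val (h (i, j)).2 = i.-1.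
  by rewrite /= inordK //; have := ltn_ord i; lia.
rewrite (reindex_onto g h) /= => [|[i j] /= ji]; last first.
  have hij : ((h (i, j)).1 <= (h (i, j)).2)%N.
    by have := h1 i j; have := h2 i j => /= -> ->; lia.
  rewrite (surjective_pairing (g _)) (surjective_pairing (h (i, j))).
  congr pair; apply: val_inj; rewrite ?g1 ?g2 ?h1 ?h2 // -?surjective_pairing //.
    by rewrite prednK // (leq_ltn_trans _ ji).
  by lia.
rewrite (eq_bigl (fun p : 'I_s.+3 * 'I_s.+2 => ~~ (p.2 < p.1)%N)); last first.
  case=> i j /=; rewrite -leqNgt; apply/andP/idP => [[ji /eqP Eij]|ij].
    rewrite leqNgt; apply/negP=> ji'.
    have [Ei Ej] : val (h (g (i, j))).1 = i /\ val (h (g (i, j))).2 = j.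
      by rewrite Eij.
    rewrite (surjective_pairing (g _)) h1 in Ei.
    by move: ji; have := g1 i j => /= ->; move: Ei => /= ->; lia.
  split; first by have := g1 i j; have := g2 i j ij => /= -> ->.
  apply/eqP; rewrite (surjective_pairing (h _)) (surjective_pairing (g _)).
  by congr pair; apply: val_inj; rewrite ?h1 ?h2 ?g1 ?g2.
rewrite -big_split big1 //= => -[i j] /=; rewrite -leqNgt => ij.
have /= E1 := g1 i j; have /= E2 := g2 i j ij.
rewrite (@face_face _ _ x _ _ j i) ?E1 ?E2 // addSn exprS mulN1r addnC.
by rewrite mulNr addNr.
Qed.

(* The spectral sequence of an extension 1 -> N -> G -> Q -> 1 with
   coefficients in the trivial module F, as the spectral sequence of the
   double complex
     C^{s,t} = Hom_Q (P_s, Hom_N (R_t, F)),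
   P and R being the standard homogeneous resolutions: P_s (resp. R_t) is free
   over F on Q^{s+1} (resp. G^{t+1}) with the diagonal left translation.  The
   total complex is filtered by the degree s, so that
     E_1^{s,t} = Hom_Q (P_s, H^t(N; F))  and  E_2^{s,t} = H^s(Q; H^t(N; F)). *)
Section LHS.

Variables (F : fieldType) (N G Q : finGroupType) (E : extension N G Q).

Definition bicochain s t := {ffun simplex Q s * simplex G t -> F}.

(* The action of q in Q on Hom_N (R_t, F) is (q f) x = f (g^-1 x), for any g in
   G above q; a Q-equivariant map is thus a function invariant under G. *)
Definition invariant s t (f : bicochain s t) : Prop :=
  forall g x y, f (shift (ext_pr E g) x, shift g y) = f (x, y).

Definition dh s t (f : bicochain s t) : bicochain s.+1 t :=
  [ffun c => \sum_(i < s.+2) (-1) ^+ i * f (face i c.1, c.2)].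

(* The sign (-1)^s makes the two differentials anticommute. *)
Definition dv s t (f : bicochain s t) : bicochain s t.+1 :=
  [ffun c => \sum_(i < t.+2) (-1) ^+ (s + i) * f (c.1, face i c.2)].

(* A family of cochains in all bidegrees; the elements of degree m of the total
   complex are the invariant families that are concentrated in the bidegrees
   (s, t) with s + t = m. *)
Definition family := forall s t, bicochain s t.

Definition tot (m : nat) (z : family) : Prop :=
  (forall s t, invariant (z s t)) /\
  (forall s t, (s + t != m)%N -> z s t = 0).

Definition fil (j : nat) (z : family) : Prop :=
  forall s t, (s < j)%N -> z s t = 0.

(* Tot^{m-1}, which is 0 for m = 0. *)
Definition tot_pred (m : nat) (z : family) : Prop :=
  if m is i.+1 then tot i z else forall s t, z s t = 0.

Definition totd (z : family) : family := fun s t =>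
  (if s is s'.+1 return bicochain s t then dh (z s' t) else 0) +
  (if t is t'.+1 return bicochain s t then dv (z s t') else 0).

(* E_k^{s,t} = Z_k^{s,t} / B_k^{s,t}, where for m = s + t
     Z_k^{s,t} = {z in F^s Tot^m | d z in F^{s+k} Tot^{m+1}},
     B_k^{s,t} = Z_{k-1}^{s+1,t-1} + (d (F^{s-k+1} Tot^{m-1}) :&: F^s Tot^m),
   and d_k : E_k^{s,t} -> E_k^{s+k,t-k+1} is induced by d.  Both are indexed
   here by s and the total degree m.  The truncated subtraction in [s.+1 - k]
   is harmless, as F^j is the whole complex for all j <= 0. *)
Definition ssZ (k s m : nat) (z : family) : Prop :=
  [/\ tot m z, fil s z & fil (s + k) (totd z)].

Definition ssB (k s m : nat) (b : family) : Prop :=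
  exists z w : family,
    [/\ ssZ k.-1 s.+1 m z,
        [/\ tot_pred m w, fil (s.+1 - k) w & fil s (totd w)]
      & forall i j, b i j = z i j + totd w i j].

(* ssB_sub, ssZ_totd and ssB_totd below show that d_k is well defined. *)
Definition ss_differential_vanishes (k s t : nat) : Prop :=
  forall z, ssZ k s (s + t) z -> ssB k (s + k) (s + t).+1 (totd z).

Definition lhs_collapses_at_E2 : Prop :=
  forall k s t, (2 <= k)%N -> ss_differential_vanishes k s t.

Lemma dh_dh s t (f : bicochain s t) : dh (dh f) = 0.
Proof.
apply/ffunP=> -[x y]; rewrite !ffunE /=.
rewrite -[RHS](sum_face_face x (fun a => f (a, y))); apply: eq_bigr => i _.
by rewrite ffunE mulr_sumr; apply: eq_bigr => j _; rewrite /= mulrA exprD.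
Qed.

Lemma dv_dv s t (f : bicochain s t) : dv (dv f) = 0.
Proof.
apply/ffunP=> -[x y]; rewrite !ffunE /=.
rewrite -[RHS](sum_face_face y (fun b => f (x, b))); apply: eq_bigr => i _.
rewrite ffunE mulr_sumr; apply: eq_bigr => j _; rewrite /= mulrA -exprD.
by rewrite addnACA exprD addnn -mul2n exprM sqrrN !expr1n mul1r.
Qed.

Lemma dh_dv s t (f : bicochain s t) : dh (dv f) + dv (dh f) = 0.
Proof.
apply/ffunP=> -[x y]; rewrite !ffunE /=.
under eq_bigr do rewrite ffunE mulr_sumr.
rewrite exchange_big -big_split big1 //= => i _.
rewrite ffunE mulr_sumr -big_split big1 //= => j _.
by rewrite !mulrA -!exprD !addSn exprS mulN1r mulNr [(j + _)%N]addnC addrN.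
Qed.

Lemma dh0 s t : dh (0 : bicochain s t) = 0.
Proof. by apply/ffunP=> c; rewrite !ffunE big1 // => i _; rewrite ffunE mulr0. Qed.

Lemma dv0 s t : dv (0 : bicochain s t) = 0.
Proof. by apply/ffunP=> c; rewrite !ffunE big1 // => i _; rewrite ffunE mulr0. Qed.

Lemma dhD s t (f g : bicochain s t) : dh (f + g) = dh f + dh g.
Proof.
apply/ffunP=> c; rewrite !ffunE -big_split; apply: eq_bigr => i _.
by rewrite ffunE mulrDr.
Qed.

Lemma dvD s t (f g : bicochain s t) : dv (f + g) = dv f + dv g.
Proof.
apply/ffunP=> c; rewrite !ffunE -big_split; apply: eq_bigr => i _.
by rewrite ffunE mulrDr.
Qed.

Lemma invariant0 s t : invariant (0 : bicochain s t).
Proof. by move=> g x y; rewrite !ffunE. Qed.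

Lemma invariantD s t (f g : bicochain s t) :
  invariant f -> invariant g -> invariant (f + g).
Proof. by move=> If Ig h x y; rewrite !ffunE If Ig. Qed.

Lemma invariant_dh s t (f : bicochain s t) : invariant f -> invariant (dh f).
Proof.
move=> If g x y; rewrite !ffunE; apply: eq_bigr => i _.
by rewrite /= face_shift If.
Qed.

Lemma invariant_dv s t (f : bicochain s t) : invariant f -> invariant (dv f).
Proof.
move=> If g x y; rewrite !ffunE; apply: eq_bigr => i _.
by rewrite /= face_shift If.
Qed.

Lemma totd_ext (z z' : family) :
  (forall s t, z s t = z' s t) -> forall s t, totd z s t = totd z' s t.
Proof. by move=> e [|s] [|t]; rewrite /totd ?e. Qed.

Lemma totdD (z z' : family) s t :
  totd (fun s t => z s t + z' s t) s t = totd z s t + totd z' s t.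
Proof.
by case: s t => [|s] [|t]; rewrite /totd ?dhD ?dvD ?addr0 ?add0r // addrACA.
Qed.

Lemma totd_totd (z : family) s t : totd (totd z) s t = 0.
Proof.
case: s t => [|[|s]] [|[|t]];
  rewrite /totd ?dhD ?dvD ?dh0 ?dv0 ?dh_dh ?dv_dv ?addr0 ?add0r ?dh_dv //.
Qed.

Lemma totd_tot m z : tot m z -> tot m.+1 (totd z).
Proof.
case=> Iz Dz; split=> [[|s] [|t]|[|s] [|t]]; rewrite /totd ?addr0 ?add0r.
- exact: invariant0.
- exact: invariant_dv.
- exact: invariant_dh.
- by apply: invariantD; [apply: invariant_dh | apply: invariant_dv].
- by [].
- by move=> st; rewrite Dz ?dv0.
- by move=> st; rewrite Dz ?dh0.
- by rewrite addSn addnS !eqSS => st; rewrite !Dz ?dv0 ?dh0 ?addr0 ?addnS.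
Qed.

Lemma totd_fil j z : fil j z -> fil j (totd z).
Proof.
move=> Fz [|s] [|t] sj; rewrite /totd ?addr0 ?add0r //.
- by rewrite Fz ?dv0.
- by rewrite Fz ?dh0 // ltnW.
- by rewrite !Fz ?dh0 ?dv0 ?addr0 // ltnW.
Qed.

Lemma tot0 m : tot m (fun _ _ => 0).
Proof. by split=> // s t; apply: invariant0. Qed.

Lemma tot_ext m z z' : (forall s t, z s t = z' s t) -> tot m z -> tot m z'.
Proof. by move=> e [Iz Dz]; split=> s t; rewrite -e; [apply: Iz | apply: Dz]. Qed.

Lemma totD m z z' : tot m z -> tot m z' -> tot m (fun s t => z s t + z' s t).
Proof.
case=> Iz Dz [Iz' Dz']; split=> s t; first exact: invariantD.
by move=> st; rewrite Dz ?Dz' ?addr0.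
Qed.

Lemma ssZ_totd k s m z : ssZ k s m z -> ssZ k (s + k) m.+1 (totd z).
Proof.
case=> Tz Fz Dz; split=> //; first exact: totd_tot.
by move=> i j _; rewrite totd_totd.
Qed.

Lemma ssB_sub k s m b : (0 < k)%N -> ssB k s m b -> ssZ k s m b.
Proof.
move=> k0 [z [w [[Tz Fz Dz] [Tw Fw Dw] e]]].
have Td : tot m (totd w).
  case: m Tw {Tz} => [w0|m]; last exact: totd_tot.
  apply: tot_ext (tot0 0) => i j.
  by case: i j => [|i] [|j]; rewrite /totd ?w0 ?dh0 ?dv0 ?addr0.
split.
- by apply: tot_ext (totD Tz Td) => i j; rewrite e.
- by move=> i j si; rewrite e Fz ?Dw ?addr0 // ltnW.
- move=> i j si; rewrite (totd_ext e) totdD totd_totd addr0 Dz //.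
  by rewrite addSn -addnS prednK.
Qed.

Lemma ssB_totd k s m b : (0 < k)%N -> ssB k s m b -> ssB k (s + k) m.+1 (totd b).
Proof.
move=> k0 [z [w [[Tz Fz Dz] _ e]]].
exists (fun _ _ => 0), z; split.
- split=> //; first exact: tot0.
  by move=> [|i] [|j] _; rewrite /totd ?dh0 ?dv0 ?addr0.
- split=> //; first by rewrite -addSn addnK.
  by move=> i j si; rewrite Dz // addSn -addnS prednK.
- by move=> i j; rewrite (totd_ext e) totdD totd_totd addr0 add0r.
Qed.

End LHS.

(* Main.v *)
(* The proof exhibits a class of E_2^{0,2(q-1)}, q = p^n, that does not survive.
   Let y_1, ..., y_n be the classes in H^2(K; F_p) of the carry cocycles of the
   coordinates of K = (Z/p^r)^n.  Their span is, as a module over Aut K, the dual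
   of F_p^n, so that the sum f of the (q-1)-st powers of all F_p-linear forms in
   the y_i is invariant (f is a Dickson invariant up to sign).  If the spectral
   sequence collapsed, f would be the restriction of a class of Hol K.

   An element b of order p generates a cyclic group whose periodic resolution
   gives divided power operations gamma_k(b) of degree -2k on the cohomology of
   any group in which b is central; on K they act on polynomials in the y_i as
   divided powers of derivations.  The subgroup generated by K and the scalar
   automorphism s = 1 + p^(r-1) centralises p^(r-1) K, so these operations can be
   applied to the restriction to it of an extension of f: a suitable sequence of
   them turns f into a nonzero multiple of y_n.  This gives a central extension
   by F_p in which the lifts A of the last basis vector have order p^(r+1).  But
   conjugation by a lift S of s sends A to A^u times an element of F_p, with
   u = 1 + p^(r-1), and S^p is central, so that A = A^(u^p); this is absurd, as
   p^(r+1) does not divide u^p - 1. *)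
From HB Require Import structures.
From mathcomp Require Import all_boot all_order all_algebra all_fingroup.
From mathcomp Require Import finfield ring zify.
Require Import Defs.

Set Implicit Arguments.
Unset Strict Implicit.
Unset Printing Implicit Defensive.

Import GRing.Theory.

Local Open Scope ring_scope.

(** * Cochains as functions on sequences, and slant operations *)

Section Coboundary.
Variables (T : Type) (R : comNzRingType).
Implicit Types (phi psi : seq T -> R) (l m : seq T) (x : T).

(* A homogeneous t-cochain is a function on sequences of length t+1; all degrees
   are treated at once, the empty sequence being in degree -1. *)
Fixpoint cobd phi l : R :=
  if l is x :: l' then phi l' - cobd (fun m => phi (x :: m)) l' else 0.

Lemma eq_cobd phi psi : phi =1 psi -> cobd phi =1 cobd psi.
Proof.
move=> e l; elim: l phi psi e => //= x l IH phi psi e.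
by rewrite e; congr (_ - _); apply: IH => m; apply: e.
Qed.

Lemma cobdD phi psi l : cobd (fun m => phi m + psi m) l = cobd phi l + cobd psi l.
Proof.
elim: l phi psi => [|x l IH] phi psi /=; first by rewrite addr0.
by rewrite IH opprD addrACA.
Qed.

Lemma cobdZ a phi l : cobd (fun m => a * phi m) l = a * cobd phi l.
Proof.
elim: l phi => [|x l IH] phi /=; first by rewrite mulr0.
by rewrite IH mulrBr.
Qed.

Lemma cobdB phi psi l : cobd (fun m => phi m - psi m) l = cobd phi l - cobd psi l.
Proof.
rewrite -[in RHS]mulN1r -cobdZ -cobdD; apply: eq_cobd => m.
by rewrite mulN1r.
Qed.

Lemma cobd_sum (I : finType) (P : pred I) (phi : I -> seq T -> R) l :
  cobd (fun m => \sum_(i | P i) phi i m) l = \sum_(i | P i) cobd (phi i) l.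
Proof.
elim: l phi => [|x l IH] phi /=; first by rewrite big1.
by rewrite IH sumrB.
Qed.

Lemma cobd_sumE phi l :
  cobd phi l = \sum_(i < size l) (-1) ^+ i * phi (take i l ++ drop i.+1 l).
Proof.
elim: l phi => [|x l IH] phi /=; first by rewrite big_ord0.
rewrite big_ord_recl /= expr0 mul1r drop0 IH -sumrN; congr (_ + _).
by apply: eq_bigr => i _; rewrite /= exprS mulN1r mulNr.
Qed.

(* [cup1] and [cup2] are the cup products with a 1-cochain and a 2-cochain. *)
Definition cup1 (h : T -> T -> R) phi l : R :=
  if l is x :: (y :: _) as l' then h x y * phi l' else 0.

Definition cup2 (u : T -> T -> T -> R) phi l : R :=
  if l is x :: y :: (z :: _) as l' then u x y z * phi l' else 0.

Definition cocycle2 (u : T -> T -> T -> R) :=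
  forall x y z t, u y z t - u x z t + u x y t - u x y z = 0.

(** Leibniz rule. The value in degree -1 must vanish: on a sequence of length two the right side
    contains [cobd phi [:: y]], which is [phi [::]], while the left side is zero. *)
Lemma cobd_cup1 h phi l : phi [::] = 0 ->
  cobd (cup1 h phi) l =
  cup2 (fun x y z => h y z - h x z + h x y) phi l - cup1 h (cobd phi) l.
Proof.
move=> phi0; case: l => [|x [|y [|z l]]] /=; rewrite ?subr0 ?phi0 ?mulr0 ?subrr //.
rewrite (@cobdZ (h x y) (fun m => phi (y :: z :: m))); ring.
Qed.

Lemma cobd_cup2 u phi l : cocycle2 u -> phi [::] = 0 ->
  cobd (cup2 u phi) l = cup2 u (cobd phi) l.
Proof.
move=> cu phi0; case: l => [|x [|y [|z [|t l]]]] /=;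
  rewrite ?subr0 ?phi0 ?mulr0 ?subrr //.
rewrite (@cobdZ (u x y z) (fun m => phi (z :: t :: m))).
have -> : u y z t = u x z t - u x y t + u x y z.
  by have /eqP := cu x y z t; rewrite subr_eq0 => /eqP <-; ring.
ring.
Qed.

Lemma eq_cup2 u phi psi : phi =1 psi -> cup2 u phi =1 cup2 u psi.
Proof. by move=> e [|x [|y [|z l]]] //=; rewrite e. Qed.

Fixpoint cup2_exp (u : T -> T -> T -> R) k : seq T -> R :=
  if k is k'.+1 then cup2 u (cup2_exp u k') else fun l => (size l == 1)%:R.

Lemma cup2_exp_nil u k : cup2_exp u k [::] = 0.
Proof. by case: k. Qed.

Lemma cobd_cup2_exp u k l : cocycle2 u -> cobd (cup2_exp u k) l = 0.
Proof.
move=> cu; elim: k l => [|k IH] l; last first.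
  rewrite (@cobd_cup2 u (cup2_exp u k)) // ?cup2_exp_nil // (eq_cup2 _ IH).
  by case: l => [|x [|y [|z l]]] //=; rewrite mulr0.
case: l => [|x [|y [|z l]]] //=; rewrite ?subr0 ?subrr //.
rewrite cobd_sumE big1 ?subrr ?oppr0 // => i _.
by rewrite mulr0.
Qed.

Lemma cobd_map (S : Type) (f : S -> T) phi (l : seq S) :
  cobd phi [seq f i | i <- l] =
  \sum_(i < size l) (-1) ^+ i * phi [seq f j | j <- take i l ++ drop i.+1 l].
Proof.
rewrite cobd_sumE size_map; apply: eq_bigr => i _.
by rewrite map_cat map_take map_drop.
Qed.

End Coboundary.

Lemma cobd_comp (S T : Type) (R : comNzRingType) (f : S -> T) (phi : seq T -> R) l :
  cobd (fun m => phi (map f m)) l = cobd phi (map f l).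
Proof. by rewrite cobd_map cobd_sumE. Qed.

(** * Slant products with the periodic resolution of a cyclic group *)

Section Slant.
Variables (gT : finGroupType) (R : comNzRingType).
Implicit Types (phi psi : seq gT -> R) (l m : seq gT) (x b g : gT).

Definition translate g phi l := phi [seq (g * x)%g | x <- l].

Variables (b : gT) (e : nat).

(* The differential of the periodic resolution of the cyclic group <[b]> of
   order [e], from degree [k] to degree [k.-1]. *)
Definition per_diff k phi l : R :=
  if odd k then translate b phi l - phi l
  else \sum_(i < e) translate (b ^+ i)%g phi l.

(* [slant k phi] is [phi] evaluated on the cross products of simplices with the
   image in the bar resolution of the generator of degree [k] of the periodic
   resolution of <[b]>. *)
Fixpoint slant k : (seq gT -> R) -> seq gT -> R :=
  if k is k'.+1 then
    fix slant_k phi l := if l is x :: l' then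
      slant k' (per_diff k (fun m => phi (x :: m))) l
        + (-1) ^+ k * slant_k (fun m => phi (x :: m)) l'
    else 0
  else fun phi => phi.

Lemma slantS k phi x l : slant k.+1 phi (x :: l) =
  slant k (per_diff k.+1 (fun m => phi (x :: m))) (x :: l)
    + (-1) ^+ k.+1 * slant k.+1 (fun m => phi (x :: m)) l.
Proof. by []. Qed.

Lemma slant_deg0 phi : slant 0 phi = phi.
Proof. by []. Qed.

Lemma slant_nil k phi : slant k.+1 phi [::] = 0.
Proof. by []. Qed.

Arguments slant : simpl never.

Lemma eq_per_diff k phi psi : phi =1 psi -> per_diff k phi =1 per_diff k psi.
Proof.
move=> E l; rewrite /per_diff /translate; case: ifP => _; first by rewrite !E.
by apply: eq_bigr => i _; rewrite /= E.
Qed.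

Lemma per_diff_lin k a phi psi l :
  per_diff k (fun m => a * phi m + psi m) l = a * per_diff k phi l + per_diff k psi l.
Proof.
rewrite /per_diff /translate; case: ifP => _; first by ring.
by rewrite big_split mulr_sumr.
Qed.

Lemma per_diff_cobd k phi l : per_diff k (cobd phi) l = cobd (per_diff k phi) l.
Proof.
rewrite /per_diff; case: ifP => _.
  by rewrite cobdB /translate cobd_comp.
by rewrite cobd_sum; apply: eq_bigr => i _; rewrite /translate cobd_comp.
Qed.

Lemma translateM g h phi l :
  translate g (translate h phi) l = translate (h * g)%g phi l.
Proof.
rewrite /translate -map_comp; congr phi; apply: eq_map => x /=.
by rewrite mulgA.
Qed.

(** In the group ring of the cyclic group, the product of b - 1 and the norm element is zero in
    either order; [tel] is the cyclic shift of the norm. *)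
Lemma per_diff_per_diff k phi l : (b ^+ e = 1)%g ->
  per_diff k (per_diff k.+1 phi) l = 0.
Proof.
move=> be; have tel m : \sum_(i < e) translate (b ^+ i.+1)%g phi m =
                         \sum_(i < e) translate (b ^+ i)%g phi m.
  apply/eqP; rewrite -subr_eq0 -sumrB.
  rewrite -(big_mkord xpredT (fun i =>
    translate (b ^+ i.+1)%g phi m - translate (b ^+ i)%g phi m)).
  by rewrite telescope_sumr // be expg0 subrr.
rewrite /per_diff /=; case: (odd k) => /=.
  apply/eqP; rewrite subr_eq0; apply/eqP; rewrite -[RHS]tel.
  rewrite [LHS]/translate; apply: eq_bigr => i _.
  by rewrite -[LHS]/(translate b (translate _ _) _) translateM expgSr.
rewrite -[RHS](subrr (\sum_(i < e) translate (b ^+ i)%g phi l)).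
rewrite -[X in _ = X - _]tel -sumrB; apply: eq_bigr => i _.
rewrite {1}/translate -[X in X - _]/(translate (b ^+ i)%g (translate b phi) l).
by rewrite translateM expgS.
Qed.

Lemma eq_slant k phi psi : phi =1 psi -> slant k phi =1 slant k psi.
Proof.
elim: k phi psi => // k IHk phi psi E l.
elim: l phi psi E => // x l IHl phi psi E.
by rewrite !slantS; congr (_ + _ * _);
  [apply: IHk; apply: eq_per_diff => m | apply: IHl => m]; apply: E.
Qed.

Lemma eq_slant_head k phi psi x l :
  (forall m, phi (x :: m) = psi (x :: m)) -> slant k phi (x :: l) = slant k psi (x :: l).
Proof.
case: k => [|k] E; first exact: E.
rewrite !slantS; congr (_ + _ * _); last exact: eq_slant.
by apply: eq_slant; apply: eq_per_diff.
Qed.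

Lemma slant_lin k a phi psi l :
  slant k (fun m => a * phi m + psi m) l = a * slant k phi l + slant k psi l.
Proof.
elim: k phi psi l => // k IHk phi psi l.
elim: l phi psi => [|x l IHl] phi psi; first by rewrite !slant_nil mulr0 addr0.
rewrite !slantS IHl (eq_slant _ (per_diff_lin _ a _ _)) IHk; ring.
Qed.

Lemma slant0 k l : slant k (fun _ => 0) l = 0.
Proof.
have := slant_lin k 1 (fun _ => 0) (fun _ => 0) l.
rewrite (@eq_slant k _ (fun _ => 0)) => [/eqP|m]; last by rewrite mulr0 addr0.
by rewrite mul1r -subr_eq subrr => /eqP.
Qed.

Lemma slantZ k a phi l : slant k (fun m => a * phi m) l = a * slant k phi l.
Proof.
rewrite -[RHS]addr0 -[X in _ + X](slant0 k l) -slant_lin.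
by apply: eq_slant => m; rewrite addr0.
Qed.

Lemma slantD k phi psi l :
  slant k (fun m => phi m + psi m) l = slant k phi l + slant k psi l.
Proof.
rewrite -[slant k phi l]mul1r -slant_lin.
by apply: eq_slant => m; rewrite mul1r.
Qed.

Lemma slantB k phi psi l :
  slant k (fun m => phi m - psi m) l = slant k phi l - slant k psi l.
Proof.
rewrite -[in RHS]mulN1r addrC -slant_lin.
by apply: eq_slant => m; rewrite mulN1r addrC.
Qed.

Lemma slant_sum k (I : finType) (P : pred I) (phi : I -> seq gT -> R) l :
  slant k (fun m => \sum_(i | P i) phi i m) l = \sum_(i | P i) slant k (phi i) l.
Proof.
rewrite (@eq_slant k _ (fun m => \sum_(i <- enum P) phi i m)) => [|m]; last first.
  by rewrite big_enum.
rewrite -big_enum /=; elim: (enum P) => [|i s IH].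
  by rewrite big_nil (@eq_slant k _ (fun _ => 0)) ?slant0 // => m; rewrite big_nil.
rewrite big_cons -IH -slantD; apply: eq_slant => m.
by rewrite big_cons.
Qed.

(** The boundary of a cross product falls either on the simplex or on the periodic generator; the
    latter gives the [per_diff] term. In the induction, the nested second differential dies by
    [per_diff_per_diff]. *)
Lemma cobd_slant k phi l : (b ^+ e = 1)%g ->
  cobd (slant k phi) l = (-1) ^+ k *
    (slant k (cobd phi) l - if k is k'.+1 then slant k' (per_diff k phi) l else 0).
Proof.
move=> be; elim: k phi l => [|k IHk] phi l.
  by rewrite !slant_deg0 expr0 subr0 mul1r.
elim: l phi => [|x l IHl] phi.
  case: k {IHk} => [|k]; rewrite !slant_nil; last by rewrite subr0 mulr0.
  by rewrite slant_deg0 /per_diff /translate /= subrr subr0 mulr0.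
rewrite -[cobd (slant k.+1 phi) (x :: l)]/(slant k.+1 phi l - cobd (fun m =>
  slant k (per_diff k.+1 (fun m => phi (x :: m))) (x :: m)
  + (-1) ^+ k.+1 * slant k.+1 (fun m => phi (x :: m)) m) l).
rewrite cobdD cobdZ IHl.
set th := per_diff k.+1 (fun m => phi (x :: m)).
have := IHk th (x :: l).
have -> : (if k is k'.+1 then slant k' (per_diff k th) (x :: l) else 0) = 0.
  case: k @th {IHk IHl} => // k th.
  by rewrite (@eq_slant k _ (fun _ => 0)) ?slant0 // => m; apply: per_diff_per_diff.
rewrite subr0 [cobd _ (x :: l)]/= => /eqP.
rewrite subr_eq addrC -subr_eq => /eqP <-.
rewrite !slantS.
have -> : slant k (per_diff k.+1 (fun m => cobd phi (x :: m))) (x :: l) =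
   slant k (per_diff k.+1 phi) (x :: l) - slant k (cobd th) (x :: l).
  rewrite -slantB; apply: eq_slant => m.
  rewrite -per_diff_cobd.
  rewrite -[X in _ - X]mul1r addrC -mulNr -per_diff_lin; apply: eq_per_diff => {}m /=.
  by rewrite mulN1r addrC.
have -> : slant k.+1 (fun m => cobd phi (x :: m)) l =
   slant k.+1 phi l - slant k.+1 (cobd (fun m => phi (x :: m))) l.
  by rewrite -slantB.
rewrite -/th exprS.
have [] : (-1) ^+ k = 1 :> R \/ (-1) ^+ k = -1 :> R.
  by rewrite -signr_odd; case: (odd k); [right|left].
by move=> ->; ring.
by move=> ->; ring.
Qed.

Lemma translate_expg phi i l : translate b phi =1 phi ->
  translate (b ^+ i)%g phi l = phi l.
Proof.
move=> Ib; elim: i l => [|i IH] l.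
  rewrite /translate; congr phi; rewrite -[RHS]map_id; apply: eq_map => x.
  by rewrite mul1g.
by rewrite expgS -translateM -(IH l); apply: Ib.
Qed.

(** For even [k] the correction term of [cobd_slant] is a norm, which multiplies an invariant
    cochain by [e], hence is zero in [R]. *)
Lemma slant_even_cobd k phi l : (b ^+ e = 1)%g -> e%:R = 0 :> R ->
  ~~ odd k -> translate b phi =1 phi ->
  cobd (slant k phi) l = slant k (cobd phi) l.
Proof.
move=> be e0 ek Ib; rewrite cobd_slant // -signr_odd (negPf ek) mul1r.
case: k ek => [|k] ek; first by rewrite subr0.
rewrite (@eq_slant k _ (fun _ => 0)) ?slant0 ?subr0 // => m.
rewrite /per_diff (negPf ek) (eq_bigr (fun _ => phi m)) => [|i _]; last first.
  exact: translate_expg.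
by rewrite sumr_const card_ord -mulr_natr e0 mulr0.
Qed.

Lemma slant_supp0 k phi l : (forall x m, phi (x :: m) = 0) ->
  slant k.+1 phi l = 0 /\ (forall x, slant k phi (x :: l) = 0).
Proof.
move=> p0; have H j x m : slant j phi (x :: m) = 0.
  by rewrite (@eq_slant_head _ _ (fun _ => 0)) ?slant0.
by split=> //; case: l.
Qed.

(** On a nonempty [l], this slant evaluates [phi] on sequences that are [k.+1] longer, thus of
    length at least two. *)
Lemma slant_size1 k phi l : (forall x y m, phi (x :: y :: m) = 0) ->
  slant k.+1 phi l = 0.
Proof.
move=> p0; case: l => // x l; rewrite slantS.
have q0 y m : phi (x :: y :: m) = 0 by [].
rewrite (slant_supp0 k l q0).1 mulr0 addr0.
rewrite (@eq_slant_head _ _ (fun _ => 0)) ?slant0 // => m.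
by rewrite /per_diff /translate /= !q0 subrr; case: ifP => // _; rewrite big1.
Qed.

(* No homotopy is needed: expanding the first two steps, the two mixed terms
   cancel because [u] is symmetric, and the term with two steps in the
   direction of [b] gives [kappa]. *)
Lemma slant_cup2 (u : gT -> gT -> gT -> R) (kappa : R) k phi l :
  (forall x y, u x y y = 0) ->
  (forall i x y, u x (b ^+ i * x)%g (b ^+ i * y)%g = u x y (b ^+ i * y)%g) ->
  (forall x, \sum_(i < e) u x (b ^+ i * x)%g (b ^+ i.+1 * x)%g = kappa) ->
  translate b phi =1 phi -> phi [::] = 0 -> ~~ odd k ->
  slant k.+2 (cup2 u phi) l = kappa * slant k phi l + cup2 u (slant k.+2 phi) l.
Proof.
move=> u0 us uk Ib p0 ek; case: l => [|x l].
  by case: k ek => [|k] _; rewrite ?slant_deg0 ?slant_nil /= ?p0 mulr0 addr0.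
have sg j : (-1) ^+ j = (if odd j then -1 else 1) :> R.
  by rewrite -signr_odd; case: odd.
have Ibi i m : phi [seq (b ^+ i * y)%g | y <- m] = phi m := translate_expg i m Ib.
pose chi z := \sum_(i < e)
  cup2 u phi (x :: (b ^+ i * x)%g :: [seq (b ^+ i * y)%g | y <- z]).
have -> : slant k.+2 (cup2 u phi) (x :: l) = slant k (per_diff k.+1 chi) (x :: l)
    - slant k.+1 chi l + slant k.+2 (fun m => cup2 u phi (x :: m)) l.
  rewrite slantS sg /= negbK (negPf ek) mul1r slantS sg /= ek mulN1r.
  congr (_ + _); congr (_ - _); last first.
    by apply: eq_slant => z; rewrite /per_diff /= negbK (negPf ek).
  apply: eq_slant; apply: eq_per_diff => z.
  by rewrite /per_diff /= negbK (negPf ek).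
have -> : slant k (per_diff k.+1 chi) (x :: l) = kappa * slant k phi (x :: l).
  rewrite -slantZ; apply: eq_slant_head => m.
  rewrite /per_diff /= ek /translate [X in _ - X]big1 => [|i _]; last first.
    by rewrite /= u0 mul0r.
  rewrite subr0 -(uk x) mulr_suml; apply: eq_bigr => i _.
  rewrite /= mulgA -expgSr; congr (_ * _).
  rewrite -[RHS](Ibi i.+1) /= -map_comp; congr (phi (_ :: _)).
  by apply: eq_map => y /=; rewrite mulgA -expgSr.
rewrite -addrA; congr (_ + _).
case: l => [|y l]; first by rewrite !slant_nil oppr0 addr0.
rewrite (slantS k.+1) sg /= negbK (negPf ek) mul1r addrA.
rewrite [X in X + _ + _ = _](_ : _ =
  - slant k.+1 (per_diff k.+2 (fun m => cup2 u phi [:: x, y & m])) (y :: l)).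
  rewrite addNr add0r; case: l => [|z l] //.
  by rewrite /= -slantZ; apply: eq_slant_head.
congr (- _); apply: eq_slant_head => m.
rewrite /per_diff /= negbK (negPf ek); apply: eq_bigr => i _.
by rewrite /translate /= us.
Qed.

Lemma translate_cup2_exp u k :
  (forall x y z, u (b * x)%g (b * y)%g (b * z)%g = u x y z) ->
  translate b (cup2_exp u k) =1 cup2_exp u k.
Proof.
move=> Iu; elim: k => [|k IH] l; first by rewrite /translate /= size_map.
by case: l => [|x [|y [|z l]]] //=; rewrite /translate /= Iu -[in RHS](IH (z :: l)).
Qed.

(** By [slant_cup2] the even slants act on powers of [u] as divided powers of the derivation sending
    [u] to [kappa]; Pascal's rule assembles the binomial coefficient. *)
Lemma slant_cup2_exp (u : gT -> gT -> gT -> R) (kappa : R) j k l :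
  (forall x y z, u (b * x)%g (b * y)%g (b * z)%g = u x y z) ->
  (forall x y, u x y y = 0) ->
  (forall i x y, u x (b ^+ i * x)%g (b ^+ i * y)%g = u x y (b ^+ i * y)%g) ->
  (forall x, \sum_(i < e) u x (b ^+ i * x)%g (b ^+ i.+1 * x)%g = kappa) ->
  slant j.*2 (cup2_exp u k) l = 'C(k, j)%:R * kappa ^+ j * cup2_exp u (k - j) l.
Proof.
move=> Iu u0 us uk; elim: k j l => [|k IH] [|j] l.
- by rewrite bin0 expr0 !mul1r.
- by rewrite bin0n !mul0r doubleS; apply: slant_size1.
- by rewrite bin0 expr0 !mul1r.
rewrite doubleS [cup2_exp u k.+1]/= (slant_cup2 _ u0 us uk);
  rewrite ?odd_double ?cup2_exp_nil //; last exact: translate_cup2_exp.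
rewrite IH binS natrD subSS -!doubleS (eq_cup2 _ (IH j.+1)) exprS.
have [kj|jk] := leqP k j.
  rewrite (@bin_small k j.+1) // [cup2 _ _ _](_ : _ = 0); first by ring.
  by case: l => [|x [|y [|z l]]] //=; rewrite !mul0r mulr0.
rewrite -(subnSK jk) [cup2_exp u (_.+1)]/=.
case: l => [|x [|y [|z l]]] /=; ring.
Qed.

End Slant.
Arguments slant : simpl never.

(** Only equivariance of [f] is required, so this covers both the restriction of slants along a
    homomorphism and their behaviour under left translation by an element commuting with [b]. *)
Lemma slant_comp (gT hT : finGroupType) (R : comNzRingType) (f : hT -> gT) b c e k
    (phi : seq gT -> R) l :
  (forall x, f (c * x)%g = (b * f x)%g) ->
  slant c e k (fun m => phi (map f m)) l = slant b e k phi (map f l).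
Proof.
move=> fc; have fci i x : f (c ^+ i * x)%g = (b ^+ i * f x)%g.
  elim: i x => [|i IH] x; first by rewrite !mul1g.
  by rewrite !expgSr -!mulgA IH fc.
have tr i (psi : seq gT -> R) m :
    translate (c ^+ i)%g (fun m => psi (map f m)) m =
      translate (b ^+ i)%g psi (map f m).
  rewrite /translate -!map_comp; congr psi; apply: eq_map => x /=; exact: fci.
elim: k phi l => // k IHk phi l.
elim: l phi => // x l IHl phi.
rewrite [map f _]/= !slantS (IHl (fun m => phi (f x :: m))).
congr (_ + _); rewrite -[f x :: map f l]/(map f (x :: l)) -IHk.
apply: eq_slant => m; rewrite /per_diff; case: ifP => _.
  by rewrite -[c]expg1 -[b]expg1 (tr 1%N (fun m => phi (f x :: m))).
by apply: eq_bigr => i _; rewrite (tr i (fun m => phi (f x :: m))).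
Qed.

Lemma translate_slant (gT : finGroupType) (R : comNzRingType) (b g : gT) e k
    (phi : seq gT -> R) :
  commute g b -> translate g phi =1 phi ->
  translate g (slant b e k phi) =1 slant b e k phi.
Proof.
move=> gb Ig l; rewrite /translate -(slant_comp (c := b)); last first.
  by move=> x; rewrite !mulgA gb.
exact: eq_slant.
Qed.

(** * Central extensions *)

Section CentralExtension.
Variables (gT : finGroupType) (p : nat) (X : seq gT -> 'F_p).
Hypothesis cX : forall l, cobd X l = 0.
Implicit Types (g h a s : gT) (al be : 'F_p).

(* The central extension of [gT] by 'F_p with cocycle [X] acts on gT * 'F_p;
   [hat g] is a lift of [g] and [shift_by] is the action of 'F_p.  Permutations
   are multiplied diagrammatically, so that products of lifts are reversed. *)
Definition hat_fun g (c : gT * 'F_p) :=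
  ((g * c.1)%g, c.2 + X [:: 1%g; g; (g * c.1)%g]).

Lemma hat_fun_inj g : injective (hat_fun g).
Proof.
move=> [h al] [k be] E; have /= /mulgI hk := congr1 fst E.
by have /= := congr1 snd E; rewrite hk => /addIr ->.
Qed.

Definition hat g : {perm gT * 'F_p} := perm (@hat_fun_inj g).

Definition shift_fun al (c : gT * 'F_p) := (c.1, c.2 + al).

Lemma shift_fun_inj al : injective (shift_fun al).
Proof.
move=> [h be] [k ga] E; have /= -> := congr1 fst E.
by have /= /addIr -> := congr1 snd E.
Qed.

Definition shift_by al : {perm gT * 'F_p} := perm (@shift_fun_inj al).

Lemma shift_byD al be : shift_by (al + be) = (shift_by al * shift_by be)%g.
Proof. by apply/permP=> -[h ga]; rewrite permM !permE /shift_fun /= addrA. Qed.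

Lemma shift_by0 : shift_by 0 = 1%g.
Proof. by apply/permP=> -[h ga]; rewrite perm1 permE /shift_fun /= addr0. Qed.

Lemma shift_byN al : shift_by (- al) = (shift_by al)^-1%g.
Proof. by apply/eqP; rewrite eq_sym eq_invg_mul -shift_byD subrr shift_by0. Qed.

Lemma shift_byX al k : (shift_by al ^+ k)%g = shift_by (al *+ k).
Proof.
elim: k => [|k IH]; first by rewrite shift_by0.
by rewrite expgS IH mulrS shift_byD.
Qed.

Lemma shift_by_inj : injective shift_by.
Proof.
move=> al be /permP/(_ (1%g, 0)); rewrite !permE => /(congr1 snd) /=.
by rewrite !add0r.
Qed.

Lemma hat_shift g al : commute (hat g) (shift_by al).
Proof.
by apply/permP=> -[h ga]; rewrite !permM !permE /shift_fun /hat_fun /= addrAC.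
Qed.

(** Once the value at 1, h, hk is translated by g, this is the cocycle identity on 1, g, gh, ghk. *)
Lemma hatM g h : translate g X =1 X ->
  (hat h * hat g)%g = (hat (g * h) * shift_by (X [:: 1; g; g * h]))%g.
Proof.
move=> Ig; apply/permP=> -[k al]; rewrite !permM !permE /shift_fun /hat_fun /=.
rewrite mulgA; congr (_, _); rewrite -!addrA; congr (_ + _).
have := Ig [:: 1; h; h * k]%g; rewrite /translate /= mulg1 mulgA => <-.
have := cX [:: 1; g; g * h; g * h * k]%g => /= /eqP.
rewrite subr0 subr_eq0 => /eqP ->; ring.
Qed.

Lemma hat1 : hat 1 = shift_by (X [:: 1; 1; 1])%g.
Proof.
apply/permP=> -[k al]; rewrite !permE /hat_fun /shift_fun /= mul1g.
have := cX [:: 1; 1; 1; k]%g => /= /eqP; rewrite subr0 subr_eq0 => /eqP E.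
by congr (_, _ + _); move: E; rewrite subKr => ->.
Qed.

Lemma hatX g k : translate g X =1 X ->
  (hat g ^+ k)%g = (hat (g ^+ k) *
     shift_by (\sum_(i < k) X [:: 1; g ^+ i; g ^+ i.+1]%g - X [:: 1; 1; 1]%g))%g.
Proof.
move=> Ig; elim: k => [|k IH].
  by rewrite !expg0 big_ord0 hat1 -shift_byD add0r subrr shift_by0.
have Igk : translate (g ^+ k)%g X =1 X.
  by move=> l; apply: translate_expg.
rewrite expgS IH mulgA hatM // -expgSr -mulgA -shift_byD big_ord_recr /=.
by congr (_ * shift_by _)%g; ring.
Qed.

(* The sum is the element of 'F_p by which the [P]-th power of a lift of [a]
   differs from 1. *)
Lemma cocycle_restriction_eq0 (a s : gT) u P v :
  prime p -> translate a X =1 X -> translate s X =1 X ->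
  (s * a = a ^+ u * s)%g -> (s ^+ p = 1)%g -> (a ^+ P = 1)%g ->
  u%:R = 1 :> 'F_p -> (u ^ p = (P * v).+1)%N -> v%:R != 0 :> 'F_p ->
  \sum_(i < P) X [:: 1; a ^+ i; a ^+ i.+1]%g = 0.
Proof.
move=> p_pr Ia Is sa sp aP u1 up v0.
set kappa := \sum_(i < P) _.
have AP : (hat a ^+ P)%g = shift_by kappa.
  by rewrite hatX // aP hat1 -shift_byD; congr shift_by; rewrite addrC subrK.
have [be Sp] : exists be, (hat s ^+ p)%g = shift_by be.
  by rewrite hatX // sp hat1 -shift_byD; eexists.
have [ps AS] : exists ps, (hat a ^ hat s)%g = (hat a ^+ u * shift_by ps)%g.
  have Iau : translate (a ^+ u)%g X =1 X by move=> l; apply: translate_expg.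
  have /(canLR (mulgK _)) := hatX u Ia; rewrite -shift_byN => E1.
  have /(canLR (mulgK _)) := hatM s Iau; rewrite -shift_byN => E2.
  rewrite conjgE hatM // sa -E2 -E1 !mulgA.
  by rewrite mulVg mul1g -!mulgA -!shift_byD; eexists.
have ASk k : (hat a ^ (hat s ^+ k) =
    hat a ^+ (u ^ k) * shift_by (ps *+ \sum_(i < k) u ^ i))%g.
  elim: k => [|k IH]; first by rewrite big_ord0 conjg1 shift_by0 mulg1.
  rewrite expgSr conjgM IH conjMg conjXg AS expgMn; last first.
    by apply/commute_sym/commuteX/commute_sym/hat_shift.
  rewrite -expgM -expnS -mulgA shift_byX.
  rewrite conjgE (commute_sym (hat_shift _ _)) mulKg -shift_byD -mulrnDr.
  by rewrite big_ord_recr /= addnC.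
(* Since [hat s ^+ p] is central, conjugation by it is trivial. The error exponent is a sum of p
   powers of [u], each 1 mod p, so it vanishes, and what remains is that [hat a ^+ (P * v)], the
   shift by [kappa *+ v], is the identity. *)
have := ASk p; rewrite Sp conjgE hat_shift mulKg up expgS expgM AP shift_byX.
rewrite -[ps *+ _]mulr_natr natr_sum (eq_bigr (fun _ => 1)) => [|i _]; last first.
  by rewrite natrX u1 expr1n.
rewrite sumr_const card_ord pchar_Fp_0 // mulr0 shift_by0 mulg1.
rewrite -[LHS]mulg1 => /mulgI; rewrite -shift_by0 => /shift_by_inj/esym/eqP.
by rewrite -mulr_natr mulf_eq0 (negPf v0) orbF => /eqP.
Qed.

End CentralExtension.

(** * Consequences of the collapse *)

Section Cone.
Variable T : finType.

Definition scons s (x : T) (f : simplex T s) : simplex T s.+1 :=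
  [ffun j => if unlift ord0 j is Some k then f k else x].

Lemma face_scons0 s x (f : simplex T s) : face ord0 (scons x f) = f.
Proof. by apply/ffunP=> j; rewrite !ffunE liftK. Qed.

Lemma face_sconsS s x (f : simplex T s.+1) i :
  face (lift ord0 i) (scons x f) = scons x (face i f).
Proof.
apply/ffunP=> j; rewrite !ffunE; case: (unliftP ord0 j) => [k|] ->.
  rewrite ffunE; set a := lift _ _; have -> : a = lift ord0 (lift i k).
    by apply: val_inj; rewrite /= /bump /=; lia.
  by rewrite liftK.
by have -> : lift (lift ord0 i) ord0 = ord0; [apply: val_inj | rewrite unlift_none].
Qed.

End Cone.

Lemma shift_scons (gT : finGroupType) s (g x : gT) (f : simplex gT s) :
  shift g (scons x f) = scons (g * x)%g (shift g f).
Proof.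
by apply/ffunP=> j; rewrite !ffunE; case: unliftP => [k|] //; rewrite ffunE.
Qed.

Section Collapse.
Variables (F : fieldType) (N G Q : finGroupType) (E : extension N G Q).
Implicit Types z w : family F G Q.

Lemma totdB z w s t : totd (fun s t => z s t - w s t) s t = totd z s t - totd w s t.
Proof.
apply/(canRL (addrK _)); rewrite -totdD; apply: totd_ext => i j.
exact: subrK.
Qed.

Lemma tot_sub m z w : tot E m z -> tot E m w -> tot E m (fun s t => z s t - w s t).
Proof.
move=> [Iz Dz] [Iw Dw]; split=> s t; last by move=> st; rewrite Dz // Dw // subr0.
by move=> g x y; rewrite !ffunE Iz Iw.
Qed.

(** Each vanishing differential provides a correction [w] of filtration at least 1, which pushes the
    total differential one step further down the filtration without touching the component in column
    0. *)
Lemma collapse_total_cocycle m z : lhs_collapses_at_E2 F E -> ssZ E 2 0 m z ->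
  exists z', [/\ tot E m z', forall s t, totd z' s t = 0 & z' 0 m = z 0 m].
Proof.
move=> col Zz.
have H j : exists z', ssZ E j.+2 0 m z' /\ z' 0 m = z 0 m.
  elim: j => [|j [z' [[Tz Fz Dz] e]]]; first by exists z.
  have [|a [w [[_ Fa _] [Tw Fw _] ea]]] := col j.+2 0 m isT z'.
    by split.
  exists (fun s t => z' s t - w s t); split; last first.
    by rewrite Fw ?subr0 // subSnn.
  split=> //; first exact: tot_sub.
  move=> s t st; rewrite totdB ea addrK Fa //.
(* After [m] corrections the differential has filtration m + 2 in total degree m + 1, so it is
   zero. *)
have [z' [[Tz _ Dz] e]] := H m.
exists z'; split=> // s t.
have [_ D0] := totd_tot Tz.
have [st|st] := eqVneq (s + t)%N m.+1; last exact: D0.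
by apply: Dz; lia.
Qed.

(* Contraction of the rows of the double complex: the vertex added is the image
   of the first vertex of the second factor, so that it is equivariant. *)
Definition cone s t (f : bicochain F G Q s.+1 t) : bicochain F G Q s t :=
  [ffun c : simplex Q s * simplex G t =>
     f (scons (ext_pr E (c.2 ord0)) c.1, c.2)].

Lemma dh_cone s t (f : bicochain F G Q s.+1 t) : dh (cone f) = f - cone (dh f).
Proof.
apply/ffunP=> -[x y]; rewrite !ffunE /= [X in _ - X]big_ord_recl /= face_scons0 mul1r.
rewrite opprD addrA subrr add0r -sumrN; apply: eq_bigr => i _.
by rewrite ffunE /= face_sconsS exprS mulN1r mulNr opprK.
Qed.

Lemma invariant_cone s t (f : bicochain F G Q s.+1 t) :
  invariant E f -> invariant E (cone f).
Proof.
move=> If g x y; rewrite !ffunE /= -[RHS](If g); congr (f (_, _)).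
by rewrite shift_scons ext_prM.
Qed.

Lemma cone0 s t : cone (0 : bicochain F G Q s.+1 t) = 0.
Proof. by apply/ffunP=> c; rewrite !ffunE. Qed.

(** The rows are exact in positive columns. In the last nonzero column [z] is closed for [dh], so
    subtracting the total coboundary of its cone clears that column; in column 0 this costs only a
    [dv] coboundary. *)
Lemma total_cocycle_column0 m j z :
  tot E m.+1 z -> (forall s t, totd z s t = 0) ->
  (forall s t, (j < s)%N -> z s t = 0) ->
  exists z' (w : bicochain F G Q 0 m),
    [/\ forall s t, totd z' s t = 0, forall s t, (0 < s)%N -> z' s t = 0,
        invariant E (z' 0 m.+1), invariant E w & z 0 m.+1 = z' 0 m.+1 + dv w].
Proof.
elim: j z => [|j IH] z Tz Dz z0.
  exists z, 0; split=> //; first by case: Tz.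
    exact: invariant0.
  by rewrite dv0 addr0.
pose hz : family F G Q := fun s t => cone (z s.+1 t).
have Th : tot E m hz.
  case: Tz => Iz Cz; split=> s t; first exact: invariant_cone.
  by move=> st; rewrite /hz Cz ?cone0.
have [|||z' [w [Dz' z'0 Iz' Iw e]]] := IH (fun s t => z s t - totd hz s t).
- by apply: tot_sub => //; apply: totd_tot.
- by move=> s t; rewrite totdB Dz totd_totd subrr.
- case=> // s t; rewrite ltnS => js.
  have dv_hz : (if t is t'.+1 return bicochain F G Q s.+1 t then dv (hz s.+1 t') else 0) = 0.
    by case: t => // t; rewrite /hz z0 ?cone0 ?dv0.
  rewrite /totd dv_hz addr0 /hz dh_cone.
  have -> : dh (z s.+1 t) = 0.
    have := Dz s.+2 t; rewrite /totd; case: t {dv_hz} => [|t]; rewrite ?addr0 //.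
    by rewrite (z0 s.+2) ?dv0 ?addr0.
  by rewrite cone0 subr0 subrr.
exists z', (w + hz 0 m); split=> //.
  by apply: invariantD => //; apply: (proj1 Th).
by rewrite dvD addrA -e /totd add0r subrK.
Qed.

(** Cochain form of the surjectivity of the edge map from the cohomology of G onto E_2 in column
    0. *)
Lemma collapse_extends_cocycle m z : lhs_collapses_at_E2 F E -> ssZ E 2 0 m.+1 z ->
  exists (Z : simplex G m.+1 -> F) (w : bicochain F G Q 0 m),
    [/\ invariant E w, forall g y, Z (shift g y) = Z y,
        forall y : simplex G m.+2, \sum_(i < m.+3) (-1) ^+ i * Z (face i y) = 0 &
        forall y, z 0 m.+1 ([ffun=> 1%g], y) = Z y + dv w ([ffun=> 1%g], y)].
Proof.
move=> col Zz; have [z1 [T1 D1 <-]] := collapse_total_cocycle col Zz.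
have [|z2 [w [D2 C2 I2 Iw ->]]] := @total_cocycle_column0 m m.+1 z1 T1 D1.
  by move=> s t st; apply: (proj2 T1); lia.
have dh2 : dh (z2 0 m.+1) = 0.
  by have := D2 1 m.+1; rewrite /totd C2 ?dv0 ?addr0.
have dv2 : dv (z2 0 m.+1) = 0 by have := D2 0 m.+2; rewrite /totd add0r.
(* A column 0 cochain closed for [dh] does not depend on its vertex in Q, hence it is a cochain of G
   alone. *)
have const x y : z2 0 m.+1 (x, y) = z2 0 m.+1 ([ffun=> 1%g], y).
  have /ffunP/(_ (scons (x ord0) [ffun=> 1%g], y)) := dh2.
  rewrite !ffunE big_ord_recl big_ord1 /= face_scons0 mul1r expr1 mulN1r.
  move/eqP; rewrite subr_eq0 => /eqP ->; congr (z2 _ _ (_, _)).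
  apply/ffunP=> i; rewrite !ffunE ord1.
  by case: unliftP => [k /(congr1 val)|_] //; congr (x _); apply: val_inj.
exists (fun y => z2 0 m.+1 ([ffun=> 1%g], y)), w; split=> //.
- by move=> g y; rewrite -[RHS](I2 g) [RHS]const.
- move=> y; have /ffunP/(_ ([ffun=> 1%g], y)) := dv2.
  by rewrite !ffunE => e; rewrite -[RHS]e; apply: eq_bigr.
- by move=> y; rewrite ffunE.
Qed.

End Collapse.

(** * Translation between simplices and sequences *)

Section SimplexSeq.
Variables (T : finType) (R : comNzRingType).

Lemma nth_codom_ord (x0 : T) n (y : {ffun 'I_n -> T}) (j : 'I_n) :
  nth x0 (codom y) j = y j.
Proof. by rewrite (nth_map j) ?size_enum_ord // nth_ord_enum. Qed.

Lemma codom_face s (y : simplex T s.+1) i :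
  codom (face i y) = take i (codom y) ++ drop i.+1 (codom y).
Proof.
have sy : size (codom y) = s.+2 by rewrite size_codom card_ord.
have x0 := y ord0.
apply: (@eq_from_nth _ x0) => [|j].
  rewrite size_codom card_ord size_cat size_take size_drop sy ltn_ord.
  by have := ltn_ord i; lia.
rewrite size_codom card_ord => js.
rewrite (nth_codom_ord x0 (face i y) (Ordinal js)) ffunE nth_cat size_take sy ltn_ord.
case: ltnP => ij.
  rewrite nth_take // -(nth_codom_ord x0 y); congr (nth _ _ _).
  by rewrite /= /bump leqNgt ij.
rewrite nth_drop -(nth_codom_ord x0 y); congr (nth _ _ _).
by rewrite /= /bump ij; lia.
Qed.

Lemma sum_face_codom s (S : Type) (f : T -> S) (phi : seq S -> R)
    (y : simplex T s.+1) :
  \sum_(i < s.+2) (-1) ^+ i * phi (map f (codom (face i y))) =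
  cobd phi (map f (codom y)).
Proof.
rewrite cobd_map size_codom card_ord; apply: eq_bigr => i _.
by rewrite codom_face.
Qed.

Variable x0 : T.

Definition simplex_of_seq s (l : seq T) : simplex T s :=
  [ffun j : 'I_s.+1 => nth x0 l j].

Lemma codom_simplex_of_seq s l : size l = s.+1 -> codom (simplex_of_seq s l) = l.
Proof.
move=> sl; apply: (@eq_from_nth _ x0) => [|j]; first by rewrite size_codom card_ord.
rewrite size_codom card_ord => js.
by rewrite (nth_codom_ord x0 _ (Ordinal js)) ffunE.
Qed.

Definition seq_cochain s (f : simplex T s -> R) l : R :=
  if size l == s.+1 then f (simplex_of_seq s l) else 0.

Lemma cobd_seq_cochain s (f : simplex T s -> R) l :
  cobd (seq_cochain f) l = if size l == s.+2 then
    \sum_(i < s.+2) (-1) ^+ i * f (face i (simplex_of_seq s.+1 l)) else 0.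
Proof.
have sz (i : 'I_(size l)) : size (take i l ++ drop i.+1 l) = (size l).-1.
  by rewrite size_cat size_take size_drop ltn_ord; have := ltn_ord i; lia.
rewrite cobd_sumE; case: eqP => sl; last first.
  rewrite big1 // => i _; rewrite /seq_cochain sz ifF ?mulr0 //.
  by have := ltn_ord i; lia.
rewrite sl; apply: eq_bigr => i _.
rewrite /seq_cochain size_cat size_take size_drop sl ltn_ord.
rewrite ifT; last by have := ltn_ord i; lia.
congr (_ * f _); apply/ffunP=> j; rewrite !ffunE nth_cat size_take sl ltn_ord /= /bump.
case: ltnP => ij; first by rewrite nth_take.
by rewrite nth_drop; congr nth; lia.
Qed.

End SimplexSeq.

(** * Extending an invariant class of K to the holomorph *)

Section HolCocycle.
Variables (K : finGroupType) (F : fieldType).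
Local Notation E := (hol_extension K).

(* The retraction of [Hol K] onto [K] equivariant under left translation by [K]. *)
Definition hol_act1 (u : Hol K) : K := aut_fun (hol_aut u) (hol_elt u).

Lemma hol_act1M u v :
  hol_act1 (u * v)%g = aut_fun (hol_aut u) (hol_elt u * hol_act1 v)%g.
Proof.
rewrite /hol_act1 /= aut_funM; congr (aut_fun _ _).
by rewrite aut_fun_morph -aut_funM mulgV aut_fun1.
Qed.

Lemma hol_act1_in x : hol_act1 (hol_in x) = x.
Proof. by rewrite /hol_act1 aut_fun1. Qed.

Variables (phi : seq K -> F) (psi : autG K -> seq K -> F).
Hypothesis Iphi : forall g, translate g phi =1 phi.
Hypothesis Dphi : forall l, cobd phi l = 0.
Hypothesis Ipsi : forall q g, translate g (psi q) =1 psi q.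
Hypothesis Dpsi : forall q l,
  phi (map (aut_fun q^-1%g) l) - phi l = cobd (psi q) l.

(** The twist by [q^-1] is chosen so that moving the vertex and the point together changes the
    coordinate only by a left multiplication in K, which an invariant cochain does not see. *)
Definition hol_coord (q : autG K) (u : Hol K) := aut_fun q^-1%g (hol_act1 u).

Lemma hol_coordM q u v :
  hol_coord (hol_aut u * q)%g (u * v)%g =
    (aut_fun q^-1%g (hol_elt u) * hol_coord q v)%g.
Proof.
rewrite /hol_coord hol_act1M invMg aut_funM.
rewrite -[aut_fun _ (aut_fun (hol_aut u) _)]aut_funM.
by rewrite mulVg aut_fun1 aut_fun_morph.
Qed.

Lemma codom_shift (gT : finGroupType) s (g : gT) (y : simplex gT s) :
  codom (shift g y) = [seq (g * x)%g | x <- codom y].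
Proof. by rewrite /codom -map_comp; apply: eq_map => j; rewrite /= ffunE. Qed.

(** The cocycle [phi] sits in bidegree (0, m+1), and the primitives [psi] of its failure to be
    invariant sit in bidegree (1, m): by [Dpsi] the two cancel in bidegree (1, m+1). *)
Definition hol_family m : family F (Hol K) (autG K) := fun s =>
  match s return forall t, bicochain F (Hol K) (autG K) s t with
  | 0 => fun t => if t == m.+1
      then [ffun c : simplex (autG K) 0 * simplex (Hol K) t =>
              phi (map (hol_coord (c.1 ord0)) (codom c.2))]
      else 0
  | 1 => fun t => if t == m
      then [ffun c : simplex (autG K) 1 * simplex (Hol K) t =>
              psi ((c.1 ord0)^-1 * c.1 ord_max)%g
                (map (hol_coord (c.1 ord0)) (codom c.2))]
      else 0
  | _ => fun t => 0
  end.

Lemma hol_family_ssZ m : ssZ E 2 0 m.+1 (hol_family m).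
Proof.
split=> //.
  split.
    move=> [|[|s]] t; last exact: invariant0.
      rewrite /=; case: eqP => _ g x y; rewrite !ffunE //= codom_shift -map_comp.
      rewrite -[RHS](Iphi (aut_fun (x ord0)^-1%g (hol_elt g))) /translate -map_comp.
      by congr phi; apply: eq_map => u; rewrite /= hol_coordM.
    rewrite /=; case: eqP => _ g x y; rewrite !ffunE //= codom_shift -map_comp.
    rewrite -[RHS](Ipsi _ (aut_fun (x ord0)^-1%g (hol_elt g))) /translate -map_comp.
    rewrite invMg mulgA mulgKV.
    by congr psi; apply: eq_map => u; rewrite /= hol_coordM.
  by move=> [|[|s]] t st //=; rewrite ifF //; apply/eqP=> et; move: st; rewrite et eqxx.
have dvphi t : dv (hol_family m 0 t) = 0.
  rewrite /=; case: eqP => _; last exact: dv0.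
  apply/ffunP=> -[x y]; rewrite !ffunE.
  rewrite -[RHS](Dphi (map (hol_coord (x ord0)) (codom y))).
  by rewrite -sum_face_codom; apply: eq_bigr => i _; rewrite ffunE.
move=> [|[|s]] t // _.
  by case: t => [|t]; rewrite /totd ?addr0 ?add0r ?dvphi.
have [->|tm] := eqVneq t m.+1; last first.
  rewrite /totd /= (negPf tm) dh0 add0r; case: t tm => // t.
  by rewrite eqSS => /negPf ->; apply: dv0.
apply/ffunP=> -[x y]; rewrite /totd /= !eqxx !ffunE /=.
rewrite [X in X + _]big_ord_recl [X in _ + X + _]big_ord1 /= !ffunE /=.
rewrite mul1r expr1 mulN1r.
have -> : x (lift ord0 ord0) = x ord_max by congr (x _); apply: val_inj.
have -> : x (lift (lift ord0 ord0) ord0) = x ord0 by congr (x _); apply: val_inj.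
set q := ((x ord0)^-1 * x ord_max)%g.
have -> : map (hol_coord (x ord_max)) (codom y) =
    map (aut_fun q^-1%g) (map (hol_coord (x ord0)) (codom y)).
  rewrite -map_comp; apply: eq_map => u; rewrite /= /hol_coord -aut_funM.
  by rewrite invMg invgK -mulgA mulgV mulg1.
rewrite Dpsi -sum_face_codom -big_split big1 //= => i _.
by rewrite exprD expr1 mulN1r ffunE /= mulNr subrr.
Qed.

(** At the vertex 1, [hol_coord] is the identity on K, so restriction to K recovers [phi] up to the
    coboundary of an invariant cochain. The extended cochains are zero outside one degree, whence
    the test on the length. *)
Lemma collapse_extends_hol m : lhs_collapses_at_E2 F E ->
  exists (Z : seq (Hol K) -> F) (w : seq K -> F),
  [/\ forall g, translate g Z =1 Z, forall l, cobd Z l = 0,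
      forall g, translate g w =1 w &
      forall l, Z (map (@hol_in K) l) + cobd w l =
        if size l == m.+2 then phi l else 0].
Proof.
move=> col.
have [Z [w [Iw IZ DZ e]]] := collapse_extends_cocycle col (hol_family_ssZ m).
pose w1 y : F := w ([ffun=> 1%g], y).
exists (seq_cochain 1%g Z), (fun l => seq_cochain 1%g w1 (map (@hol_in K) l)); split.
- move=> g l; rewrite /translate /seq_cochain size_map; case: eqP => // sl.
  by rewrite -[RHS](IZ g); congr Z; apply/ffunP=> j; rewrite !ffunE (nth_map 1%g) ?sl.
- by move=> l; rewrite cobd_seq_cochain; case: eqP => // _; apply: DZ.
- move=> g l; rewrite /translate /seq_cochain !size_map; case: eqP => // sl.
  rewrite /w1 -[RHS](Iw (hol_in g)); congr (w (_, _)).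
    by apply/ffunP=> j; rewrite !ffunE mulg1.
  apply/ffunP=> j; rewrite !ffunE -!map_comp !(nth_map 1%g) ?sl //=.
  by rewrite hol_inM.
move=> l; rewrite cobd_comp cobd_seq_cochain /seq_cochain !size_map.
case: eqP => sl; last by rewrite addr0.
have := e (simplex_of_seq 1%g m.+1 (map (@hol_in K) l)).
rewrite /= eqxx !ffunE /= codom_simplex_of_seq ?size_map // -map_comp.
rewrite (@eq_map _ _ _ id) ?map_id => [->|x] //.
by rewrite /= /hol_coord hol_act1_in invg1 aut_fun1.
Qed.

End HolCocycle.

(** * Powers of a 2-cocycle *)

Section CupExp.
Variables (T : Type) (R : comNzRingType).
Implicit Types (u v : T -> T -> T -> R) (l : seq T).

Lemma cup2_exp_map (S : Type) (f : S -> T) u k (l : seq S) :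
  cup2_exp u k (map f l) = cup2_exp (fun x y z => u (f x) (f y) (f z)) k l.
Proof.
elim: k l => [|k IH] l; first by rewrite /= size_map.
by case: l => [|x [|y [|z l]]] //=; rewrite -(IH (z :: l)).
Qed.

Lemma cup2_exp_size u k l : size l != k.*2.+1 -> cup2_exp u k l = 0.
Proof.
elim: k l => [|k IH] l; first by move=> /negPf /= ->.
case: l => [|x [|y [|z l]]] //= sl; rewrite (IH (z :: l)) ?mulr0 //.
Qed.

(* A primitive of [cup2_exp v k - cup2_exp u k] when [v - u] is the coboundary of
   [h]. *)
Fixpoint cup2_exp_prim u v (h : T -> T -> R) k : seq T -> R :=
  if k is k'.+1 then
    fun l => cup2 v (cup2_exp_prim u v h k') l + cup1 h (cup2_exp u k') l
  else fun _ => 0.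

(** Induction along v^(k+1) - u^(k+1) = v (v^k - u^k) + (v - u) u^k. *)
Lemma cobd_cup2_exp_prim u v h k l : cocycle2 u -> cocycle2 v ->
  (forall x y z, v x y z = u x y z + (h y z - h x z + h x y)) ->
  cobd (cup2_exp_prim u v h k) l = cup2_exp v k l - cup2_exp u k l.
Proof.
move=> cu cv uv; elim: k l => [|k IH] l.
  rewrite subrr [LHS](_ : _ = 0) //; elim: l => //= x l IH.
  by rewrite IH subrr.
have n0 : cup2_exp_prim u v h k [::] = 0 by case: (k) => //= ?; rewrite addr0.
rewrite cobdD cobd_cup2 // cobd_cup1 ?cup2_exp_nil // (eq_cup2 _ IH).
rewrite [cup1 _ _ _](_ : _ = 0); last first.
  by case: l => [|x [|y l]] //; rewrite [LHS]/= -/(cobd _ (y :: l)) cobd_cup2_exp ?mulr0.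
case: l => [|x [|y [|z l]]] /=; rewrite ?subrr ?subr0 ?addr0 //.
by rewrite uv; ring.
Qed.

End CupExp.

Lemma translate_cup2_exp_prim (gT : finGroupType) (R : comNzRingType) (b : gT)
    (u v : gT -> gT -> gT -> R) h k :
  (forall x y z, u (b * x)%g (b * y)%g (b * z)%g = u x y z) ->
  (forall x y z, v (b * x)%g (b * y)%g (b * z)%g = v x y z) ->
  (forall x y, h (b * x)%g (b * y)%g = h x y) ->
  translate b (cup2_exp_prim u v h k) =1 cup2_exp_prim u v h k.
Proof.
move=> Iu Iv Ih; elim: k => // k IH l.
rewrite /translate /=; congr (_ + _).
  by case: l => [|x [|y [|z l]]] //=; rewrite Iv -[in RHS](IH (z :: l)).
by case: l => [|x [|y l]] //=; rewrite Ih -[in RHS](translate_cup2_exp k Iu (y :: l)).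
Qed.

(** * Iterated slants along commuting elements *)

Section IteratedSlant.
Variables (gT : finGroupType) (R : comNzRingType) (e : nat).
Variables (b : nat -> gT) (k : nat -> nat).
Hypothesis be : forall i, (b i ^+ e = 1)%g.
Hypothesis bC : forall i j, commute (b i) (b j).
Hypothesis e0 : e%:R = 0 :> R.
Implicit Types (phi psi : seq gT -> R).

Fixpoint iter_slant t phi : seq gT -> R :=
  if t is t'.+1 then slant (b t') e (k t').*2 (iter_slant t' phi) else phi.

Lemma eq_iter_slant t phi psi : phi =1 psi -> iter_slant t phi =1 iter_slant t psi.
Proof. by move=> E; elim: t => //= t IH; apply: eq_slant. Qed.

Lemma iter_slant0 t l : iter_slant t (fun _ => 0) l = 0.
Proof. by elim: t l => //= t IH l; rewrite (eq_slant _ _ _ IH) slant0. Qed.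

Lemma iter_slantB t phi psi l :
  iter_slant t (fun m => phi m - psi m) l = iter_slant t phi l - iter_slant t psi l.
Proof.
elim: t l => //= t IH l; rewrite (eq_slant _ _ _ IH).
by rewrite (slantB _ _ _ (iter_slant t phi)).
Qed.

Lemma iter_slant_sum t (I : finType) (phi : I -> seq gT -> R) l :
  iter_slant t (fun m => \sum_i phi i m) l = \sum_i iter_slant t (phi i) l.
Proof.
elim: t l => //= t IH l; rewrite (eq_slant _ _ _ IH).
by rewrite (slant_sum _ _ _ xpredT (fun i => iter_slant t (phi i))).
Qed.

Lemma translate_iter_slant t g phi : (forall i, commute g (b i)) ->
  translate g phi =1 phi -> translate g (iter_slant t phi) =1 iter_slant t phi.
Proof. by move=> gb Ig; elim: t => //= t IH; apply: translate_slant. Qed.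

Lemma cobd_iter_slant t phi l : (forall i, translate (b i) phi =1 phi) ->
  cobd (iter_slant t phi) l = iter_slant t (cobd phi) l.
Proof.
move=> Ib; elim: t l => //= t IH l.
rewrite slant_even_cobd ?odd_double //; first exact: eq_slant.
by apply: translate_iter_slant.
Qed.

Lemma iter_slant_cup2_exp (u : gT -> gT -> gT -> R) (kappa : nat -> R) m t l :
  (forall g x y z, u (g * x)%g (g * y)%g (g * z)%g = u x y z) ->
  (forall x y, u x y y = 0) ->
  (forall g x y, u x (g * x)%g (g * y)%g = u x y (g * y)%g) ->
  (forall i x, \sum_(j < e) u x (b i ^+ j * x)%g (b i ^+ j.+1 * x)%g = kappa i) ->
  iter_slant t (cup2_exp u m) l =
    \prod_(i < t) ('C(m - \sum_(j < i) k j, k i)%:R * kappa i ^+ k i)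
    * cup2_exp u (m - \sum_(j < t) k j) l.
Proof.
move=> Iu u0 us uk; elim: t l => [|t IH] l.
  by rewrite !big_ord0 mul1r subn0.
rewrite /= (eq_slant _ _ _ IH) slantZ.
rewrite (slant_cup2_exp _ _ _ (Iu _) u0 _ (uk t)); last by move=> i x y; apply: us.
by rewrite !big_ord_recr /= subnDA mulrA.
Qed.

End IteratedSlant.

Lemma iter_slant_comp (gT hT : finGroupType) (R : comNzRingType) (f : hT -> gT) e b k t
    (phi : seq gT -> R) l :
  {morph f : x y / (x * y)%g} ->
  iter_slant e b k t (fun m => phi (map f m)) l =
    iter_slant e (fun i => f (b i)) k t phi (map f l).
Proof.
move=> fM; elim: t l => //= t IH l.
by rewrite -(slant_comp (c := b t)) //; apply: eq_slant.
Qed.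

(** These simplices form a 2-cycle modulo [e]: by invariance the faces omitting 1 all agree and
    contribute [e] equal terms, and the other faces telescope around the cycle. *)
Lemma sum_cobd_cycle (gT : finGroupType) (R : comNzRingType) (w : seq gT -> R) a e :
  (a ^+ e = 1)%g -> e%:R = 0 :> R -> translate a w =1 w ->
  \sum_(i < e) cobd w [:: 1; a ^+ i; a ^+ i.+1]%g = 0.
Proof.
move=> ae e0 Ia.
have E i : cobd w [:: 1; a ^+ i; a ^+ i.+1]%g =
    w [:: 1; a]%g + (w [:: 1; a ^+ i]%g - w [:: 1; a ^+ i.+1]%g).
  have := translate_expg i [:: 1; a]%g Ia; rewrite /translate /= mulg1 -expgSr => <-.
  by rewrite subr0; ring.
under eq_bigr => i _ do rewrite E.
rewrite big_split /= sumr_const card_ord.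
rewrite -mulr_natr e0 mulr0 add0r.
rewrite -(big_mkord xpredT (fun i => w [:: 1; a ^+ i]%g - w [:: 1; a ^+ i.+1]%g)).
rewrite (eq_bigr (fun i => - (w [:: 1; a ^+ i.+1]%g - w [:: 1; a ^+ i]%g))); last first.
  by move=> i _; rewrite opprB.
by rewrite sumrN telescope_sumr // ae expg0 subrr oppr0.
Qed.
Arguments iter_slant : simpl never.

(** * Carry cocycles *)

Lemma expnD1_trunc t m :
  exists w, (t.+1 ^ m = 1 + m * t + 'C(m, 2) * t ^ 2 + w * t ^ 3)%N.
Proof.
elim: m => [|m [w IH]]; first by exists 0%N.
exists (w + w * t + 'C(m, 2))%N.
by rewrite expnS IH binS bin1; ring.
Qed.

(** The prime divides C(p^a, k+1) when k+1 < p^a, so Pascal's rule flips the sign at each step. *)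
Lemma bin_pred_prime_power (p a k : nat) : prime p -> (k < p ^ a)%N ->
  'C((p ^ a).-1, k)%:R = (-1) ^+ k :> 'F_p.
Proof.
move=> p_pr; have pa0 : (0 < p ^ a)%N by rewrite expn_gt0 prime_gt0.
elim: k => [|k IH] ka; first by rewrite bin0.
have : 'C(p ^ a, k.+1)%:R = 0 :> 'F_p.
  apply/eqP; rewrite -(dvdn_pcharf (pchar_Fp p_pr)).
  apply: contraLR ka => npC; rewrite -leqNgt.
  have : (p ^ a %| k.+1 * 'C(p ^ a, k.+1))%N.
    by rewrite -mul_bin_diag dvdn_mulr.
  rewrite Gauss_dvdl; first by move/dvdn_leq => ->.
  by rewrite coprimeXl // prime_coprime.
rewrite -{1}(prednK pa0) binS natrD IH 1?ltnW // exprS => /eqP.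
by rewrite addr_eq0 => /eqP ->; rewrite mulN1r.
Qed.

Lemma sum_Fp_exp (p k : nat) : prime p -> (p.-1 %| k)%N -> (0 < k)%N ->
  \sum_(x : 'F_p) x ^+ k = -1.
Proof.
move=> p_pr /dvdnP[j ->] jp.
rewrite (bigD1 0) //= expr0n eqn0Ngt jp add0r.
rewrite (eq_bigr (fun _ => 1)) => [|x x0]; last first.
  rewrite mulnC exprM (_ : x ^+ p.-1 = 1) ?expr1n //.
  apply: (mulfI x0); rewrite mulr1 -exprS prednK ?prime_gt0 //.
  by rewrite -[RHS]expf_card card_Fp.
rewrite sumr_const cardC1 card_Fp // -subn1 natrB ?prime_gt0 // pchar_Fp_0 //.
by rewrite sub0r.
Qed.

Section CarryCocycle.
Variables (p r n : nat).
Hypothesis p_pr : prime p.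
Hypothesis r_gt0 : (0 < r)%N.
Local Notation P := (p ^ r)%N.
Local Notation N := 'rV['Z_P]_n.

Lemma prime_power_gt1 : (1 < P)%N.
Proof. by rewrite -(exp1n r) ltn_exp2r // prime_gt1. Qed.

Definition coefn (x : N) i : nat := val (x 0 i).

Lemma coefn_lt x i : (coefn x i < P)%N.
Proof. by rewrite -[X in (_ < X)%N](Zp_cast prime_power_gt1) ltn_ord. Qed.

Lemma coefnD x y i : coefn (x + y) i = ((coefn x i + coefn y i) %% P)%N.
Proof. by rewrite /coefn mxE /=; congr (_ %% _)%N; apply/Zp_cast/prime_power_gt1. Qed.

Lemma coefn0 i : coefn 0 i = 0%N.
Proof. by rewrite /coefn mxE. Qed.

Definition carry (x y z : N) i : nat :=
  ((coefn (y - x) i + coefn (z - y) i) %/ P)%N.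

Lemma carryE x y z i :
  (P * carry x y z i + coefn (z - x) i = coefn (y - x) i + coefn (z - y) i)%N.
Proof.
have -> : z - x = (y - x) + (z - y) by rewrite [RHS]addrC addrA subrK.
by rewrite coefnD mulnC -divn_eq.
Qed.

(** The coefficients are natural numbers, not residues, so that pullbacks can be compared over the
    integers and divided by [P] before reduction mod p. *)
Definition carry_cocycle (c : 'I_n -> nat) (x y z : N) : 'F_p :=
  \sum_i (c i * carry x y z i)%:R.

(** Over the integers, [P] times the carry is the coboundary of the representative; [P] is cancelled
    there. *)
Lemma carry_cocycle_cocycle c : cocycle2 (carry_cocycle c).
Proof.
move=> x y z t; rewrite /carry_cocycle -sumrB -big_split -sumrB big1 //= => i _.
have E : (c i * carry y z t i + c i * carry x y t i =
          c i * carry x z t i + c i * carry x y z i)%N.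
  rewrite -!mulnDr; congr (_ * _)%N; apply/eqP.
  rewrite -(@eqn_pmul2l P) ?expn_gt0 ?prime_gt0 // !mulnDr; apply/eqP.
  have := carryE y z t i; have := carryE x y t i.
  have := carryE x z t i; have := carryE x y z i; lia.
have {}E := congr1 (fun m => m%:R : 'F_p) E; rewrite /= !natrD in E.
by rewrite -addrA addrACA -opprD E subrr.
Qed.

Lemma carry_cocycleM c (g x y z : N) :
  carry_cocycle c (g * x)%g (g * y)%g (g * z)%g = carry_cocycle c x y z.
Proof.
have gs (a b : N) : (g * a)%g - (g * b)%g = a - b.
  by rewrite FinRing.zmodMgE FinRing.zmodMgE opprD addrACA subrr add0r.
by apply: eq_bigr => i _; rewrite /carry !gs.
Qed.

Lemma carry_cocycle_normal c (x y : N) : carry_cocycle c x y y = 0.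
Proof.
rewrite /carry_cocycle big1 // => i _.
by rewrite /carry subrr coefn0 addn0 divn_small ?coefn_lt ?muln0.
Qed.

Lemma carry_cocycle_sym c (g x y : N) :
  carry_cocycle c x (g * x)%g (g * y)%g = carry_cocycle c x y (g * y)%g.
Proof.
apply: eq_bigr => i _; rewrite /carry !FinRing.zmodMgE !addrK.
by rewrite opprD addrACA subrr add0r addnC.
Qed.

(** Adding [b] one copy at a time accumulates [e * coefn b i]; as [b *+ e] is zero, this is exactly
    [P] times the number of carries. The value serves as [kappa] in the slant formulas. *)
Lemma sum_carry_cocycle c (b x : N) e : b *+ e = 0 ->
  \sum_(j < e) carry_cocycle c x (b ^+ j * x)%g (b ^+ j.+1 * x)%g =
  \sum_i (c i * ((e * coefn b i) %/ P))%:R.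
Proof.
move=> be; rewrite exchange_big; apply: eq_bigr => i _ /=.
rewrite -natr_sum -big_distrr /=; congr (_ * _)%:R.
have P0 : (0 < P)%N by rewrite expn_gt0 prime_gt0.
have E m : (P * (\sum_(j < m) carry x (b ^+ j * x)%g (b ^+ j.+1 * x)%g i)
            + coefn (b *+ m) i = m * coefn b i)%N.
  elim: m => [|m IH]; first by rewrite big_ord0 mulr0n coefn0 muln0.
  rewrite big_ord_recr /= mulnDr mulSn -IH.
  have := carryE x (b ^+ m * x)%g (b ^+ m.+1 * x)%g i.
  have -> : (b ^+ m.+1 * x)%g - (b ^+ m * x)%g = b.
    rewrite !FinRing.zmodMgE !FinRing.zmodXgE mulrSr opprD addrACA addrN addr0.
    by rewrite addrAC addrN add0r.
  rewrite !FinRing.zmodMgE !FinRing.zmodXgE !addrK => e1.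
  by rewrite -[LHS]addnA e1 addnA addnC.
by rewrite -E be coefn0 addn0 mulKn.
Qed.

Definition std_basis j : N := delta_mx 0 j.

Lemma coefn_std_basis i j : coefn (std_basis j) i = (i == j).
Proof.
by rewrite /coefn mxE eqxx /=; case: eqP.
Qed.

Lemma natr_coefn x i : (coefn x i)%:R = x 0 i.
Proof. exact: natr_Zp. Qed.

Definition linform (c : 'I_n -> nat) (x : N) : nat := (\sum_i c i * coefn x i)%N.

Lemma linformE c x y z :
  (P * \sum_i c i * carry x y z i + linform c (z - x) =
     linform c (y - x) + linform c (z - y))%N.
Proof.
rewrite /linform big_distrr /= -!big_split; apply: eq_bigr => i _ /=.
by rewrite mulnCA -!mulnDr carryE.
Qed.

Lemma linform_std_basis c j : linform c (std_basis j) = c j.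
Proof.
rewrite /linform (bigD1 j) //= coefn_std_basis eqxx muln1 big1 ?addn0 // => i ij.
by rewrite coefn_std_basis (negPf ij) muln0.
Qed.

(** * Pulling carry cocycles back along additive maps *)

Section Pullback.
Variable f : N -> N.
Hypothesis fD : {morph f : x y / x + y}.

Definition pullback (c : 'I_n -> nat) (j : 'I_n) := linform c (f (std_basis j)).

Lemma additive_decomp x : f x = \sum_j f (std_basis j) *+ coefn x j.
Proof.
have f0 : f 0 = 0 by apply: (addrI (f 0)); rewrite -fD !addr0.
have fX y m : f (y *+ m) = f y *+ m.
  by elim: m => [|m IH]; rewrite ?mulr0n // !mulrS fD IH.
rewrite {1}(row_sum_delta x) (big_morph f fD f0); apply: eq_bigr => j _.
by rewrite -fX -scaler_nat natr_coefn.
Qed.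

Lemma pullbackP c x : linform c (f x) = linform (pullback c) x %[mod P].
Proof.
have lin y : (linform c y)%:R = \sum_i (c i)%:R * y 0 i :> 'Z_P.
  by rewrite natr_sum; apply: eq_bigr => i _; rewrite natrM natr_coefn.
rewrite -!(val_Zp_nat prime_power_gt1); congr val.
rewrite lin natr_sum.
have S i : f x 0 i = \sum_j (f (std_basis j) 0 i *+ coefn x j).
  rewrite additive_decomp summxE; apply: eq_bigr => j _.
  exact: mulmxnE.
transitivity (\sum_i \sum_j (c i)%:R * (f (std_basis j) 0 i *+ coefn x j)).
  by apply: eq_bigr => i _; rewrite -mulr_sumr; congr (_ * _); apply: S.
rewrite exchange_big; apply: eq_bigr => j _ /=.
rewrite natrM lin mulr_suml; apply: eq_bigr => i _.
by rewrite mulr_natr mulrnAr.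
Qed.

(** By [pullbackP] the two integral lifts of the form differ by a multiple of [P]; this is that
    difference divided by [P]. *)
Definition pullback_prim c (x y : N) : 'F_p :=
  (linform c (f (y - x)) %/ P)%:R - (linform (pullback c) (y - x) %/ P)%:R.

Lemma carry_cocycle_pullback c x y z :
  carry_cocycle c (f x) (f y) (f z) = carry_cocycle (pullback c) x y z +
    (pullback_prim c y z - pullback_prim c x z + pullback_prim c x y).
Proof.
have fB u v : f (u - v) = f u - f v.
  by apply/(canRL (addrK _)); rewrite -fD subrK.
have P0 : (0 < P)%N by rewrite expn_gt0 prime_gt0.
rewrite /carry_cocycle -!natr_sum.
have e1 := linformE c (f x) (f y) (f z).
have e2 := linformE (pullback c) x y z.
rewrite -!fB in e1.
set U := (\sum_i _)%N in e1 *; set V := (\sum_i _)%N in e2 *.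
rewrite /pullback_prim.
have mx := pullbackP c (y - x); have my := pullbackP c (z - y).
have mz := pullbackP c (z - x); move: mx my mz e1 e2.
set A1 := linform c (f (y - x)); set A2 := linform c (f (z - y)).
set A3 := linform c (f (z - x)); set B1 := linform _ (y - x).
set B2 := linform _ (z - y); set B3 := linform _ (z - x).
have d1 := divn_eq A1 P; have d2 := divn_eq A2 P; have d3 := divn_eq A3 P.
have d4 := divn_eq B1 P; have d5 := divn_eq B2 P; have d6 := divn_eq B3 P.
move=> m1 m2 m3 e1 e2.
have E : (U + A3 %/ P + B1 %/ P + B2 %/ P = V + B3 %/ P + A1 %/ P + A2 %/ P)%N.
  apply/eqP; rewrite -(@eqn_pmul2l P) // !mulnDr; apply/eqP.
  move: d1 d2 d3 d4 d5 d6 m1 m2 m3 e1 e2.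
  rewrite ![(_ %/ _ * _)%N]mulnC.
  move: (P * U)%N (P * V)%N (P * (A1 %/ P))%N (P * (A2 %/ P))%N (P * (A3 %/ P))%N
    (P * (B1 %/ P))%N (P * (B2 %/ P))%N (P * (B3 %/ P))%N
    (A1 %% P)%N (A2 %% P)%N (A3 %% P)%N (B1 %% P)%N (B2 %% P)%N (B3 %% P)%N.
  clear; lia.
have {}E := congr1 (fun m => m%:R : 'F_p) E; rewrite /= !natrD in E.
have -> : U%:R = (U%:R + (A3 %/ P)%:R + (B1 %/ P)%:R + (B2 %/ P)%:R)
   - (A3 %/ P)%:R - (B1 %/ P)%:R - (B2 %/ P)%:R :> 'F_p by ring.
rewrite E; ring.
Qed.

End Pullback.

Lemma natr_Fp_modn a b : a = b %[mod P] -> a%:R = b%:R :> 'F_p.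
Proof.
move=> ab; rewrite -(Fp_nat_mod p_pr a) -(Fp_nat_mod p_pr b).
have pP : (p %| P)%N by rewrite dvdn_exp.
by rewrite -(modn_dvdm a pP) ab modn_dvdm.
Qed.

Definition form_cocycle (la : {ffun 'I_n -> 'F_p}) :=
  carry_cocycle (fun i => val (la i)).

Definition pull_form (f : N -> N) (la : {ffun 'I_n -> 'F_p}) :
    {ffun 'I_n -> 'F_p} :=
  [ffun j => (pullback f (fun i => val (la i)) j)%:R].

Lemma form_cocycle_pull f la x y z :
  form_cocycle (pull_form f la) x y z =
  carry_cocycle (pullback f (fun i => val (la i))) x y z.
Proof.
by apply: eq_bigr => i _; rewrite !natrM ffunE natr_Zp.
Qed.

(** A preimage of the i-th basis vector recovers [la i] from the pulled-back form. Hence an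
    automorphism permutes the finite set of forms. *)
Lemma pull_form_inj f : {morph f : x y / x + y} -> (forall y, exists x, f x = y) ->
  injective (pull_form f).
Proof.
move=> fD fs la mu e; apply/ffunP=> i.
have [x fx] := fs (std_basis i).
have H (nu : {ffun 'I_n -> 'F_p}) : nu i = \sum_j pull_form f nu j * (coefn x j)%:R.
  have := natr_Fp_modn (pullbackP fD (fun i => val (nu i)) x).
  rewrite fx linform_std_basis natr_Zp => ->.
  by rewrite natr_sum; apply: eq_bigr => j _; rewrite natrM ffunE.
by rewrite (H la) (H mu) e.
Qed.

End CarryCocycle.

(** * The Dickson class and its invariance *)

Section DicksonClass.
Variables (p r n : nat).
Hypothesis p_pr : prime p.
Hypothesis r_gt0 : (0 < r)%N.
Local Notation N := 'rV['Z_(p ^ r)]_n.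

(* By Newton's identities, for [k = p ^ n - 1] this power sum of all linear forms
   is a Dickson invariant up to sign. *)
Definition dickson_cochain k (l : seq N) : 'F_p :=
  \sum_la cup2_exp (@form_cocycle p r n la) k l.

Definition dickson_prim k (q : autG N) (l : seq N) : 'F_p :=
  let f := aut_fun q^-1%g in
  \sum_la cup2_exp_prim (@form_cocycle p r n (pull_form f la))
    (fun x y z => form_cocycle la (f x) (f y) (f z))
    (pullback_prim f (fun i => val (la i))) k l.

Lemma translate_dickson k g : translate g (dickson_cochain k) =1 dickson_cochain k.
Proof.
move=> l; apply: eq_bigr => la _; apply: translate_cup2_exp => x y z.
exact: carry_cocycleM.
Qed.

Lemma cobd_dickson k l : cobd (dickson_cochain k) l = 0.
Proof.
by rewrite cobd_sum big1 // => la _; apply/cobd_cup2_exp/carry_cocycle_cocycle.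
Qed.

Lemma translate_dickson_prim k q g :
  translate g (dickson_prim k q) =1 dickson_prim k q.
Proof.
move=> l; apply: eq_bigr => la _; apply: translate_cup2_exp_prim => x y.
- by move=> z; apply: carry_cocycleM.
- by move=> z; rewrite !aut_fun_morph; apply: carry_cocycleM.
- rewrite /pullback_prim !FinRing.zmodMgE.
  by rewrite opprD addrACA subrr add0r.
Qed.

(** Reindexing the sum by the permutation [pull_form] matches the terms in pairs that differ by
    explicit coboundaries. *)
Lemma cobd_dickson_prim k q l :
  dickson_cochain k (map (aut_fun q^-1%g) l) - dickson_cochain k l =
  cobd (dickson_prim k q) l.
Proof.
rewrite /dickson_prim; set f := aut_fun _.
have fD : {morph f : x y / x + y} by move=> x y; apply: aut_fun_morph.
have inj_f : injective (@pull_form p r n f).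
  apply: pull_form_inj => // y; exists (aut_fun q y).
  by rewrite /f -aut_funM mulVg aut_fun1.
rewrite [X in _ - X](reindex_inj inj_f) -sumrB cobd_sum; apply: eq_bigr => la _.
rewrite cobd_cup2_exp_prim ?cup2_exp_map //.
- exact: carry_cocycle_cocycle.
- by move=> x y z t; apply: carry_cocycle_cocycle.
- by move=> x y z; rewrite form_cocycle_pull; apply: carry_cocycle_pullback.
Qed.

End DicksonClass.

(** * Scalar automorphisms and their lifts to the holomorph *)

Section ScalarAut.
Variables (p r n u : nat).
Hypothesis p_pr : prime p.
Hypothesis r_gt0 : (0 < r)%N.
Hypothesis up : u ^ p = 1 %[mod p ^ r].
Local Notation N := 'rV['Z_(p ^ r)]_n.

Lemma mulrn_modn (x : N) a b : a = b %[mod p ^ r] -> x *+ a = x *+ b.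
Proof.
move=> ab; rewrite -!scaler_nat; congr (_ *: _).
by apply: ord_inj; rewrite !val_Zp_nat ?prime_power_gt1.
Qed.

Lemma scalar_inj : injective (fun x : N => x *+ u).
Proof.
move=> x y /(congr1 (fun z => z *+ u ^ p.-1)).
by rewrite /= -!mulrnA -expnS prednK ?prime_gt0 // !(mulrn_modn _ up).
Qed.

Lemma scalar_Aut : perm scalar_inj \in Aut [set: N].
Proof.
rewrite inE; apply/andP; split; first by apply/subsetP=> x; rewrite inE.
by apply/morphicP=> x y _ _; rewrite !permE /= FinRing.zmodMgE mulrnDl.
Qed.

Definition scalar_aut : autG N :=
  exist (fun f : {perm N} => f \in Aut [set: N]) _ scalar_Aut.

Lemma scalar_autE x : aut_fun scalar_aut x = x *+ u.
Proof. by rewrite /aut_fun permE. Qed.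

Definition scalar_hol : Hol N := MkHol scalar_aut 1%g.

Lemma scalar_hol_in x :
  (scalar_hol * hol_in x)%g = (hol_in (x *+ u) * scalar_hol)%g.
Proof.
rewrite [LHS]/(hol_mul _ _) [RHS]/(hol_mul _ _) /hol_mul /=.
rewrite mulg1 mul1g mulg1 invg1 aut_fun1 mul1g -scalar_autE.
by rewrite -aut_funM mulVg aut_fun1.
Qed.

Lemma hol_inX x k : @hol_in N (x *+ k) = (hol_in x ^+ k)%g.
Proof.
elim: k => [|k IH]; first by rewrite mulr0n.
by rewrite mulrS expgS -IH -hol_inM.
Qed.

Lemma scalar_holX : (scalar_hol ^+ p = 1)%g.
Proof.
have H k : (scalar_hol ^+ k = MkHol (scalar_aut ^+ k) 1)%g.
  elim: k => [|k IH] //; rewrite expgS IH [LHS]/(hol_mul _ _) /hol_mul /=.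
  by rewrite aut_fun_id mulg1 -expgS.
have A k x : aut_fun (scalar_aut ^+ k)%g x = x *+ u ^ k.
  elim: k x => [|k IH] x; first by rewrite aut_fun1.
  by rewrite expgS aut_funM IH scalar_autE -mulrnA expnSr.
rewrite H; congr MkHol; apply: val_inj; apply/permP=> x.
by rewrite -[LHS]/(aut_fun _ x) A (mulrn_modn _ up) perm1.
Qed.

End ScalarAut.

(** * Proof of the theorem *)

(** In the expansion of (1 + p^(r-1))^p the linear term is p^r. The quadratic term is divisible by
    p^(r+1) because C(p,2) contributes a factor p if p is odd, and because 2(r-1) >= r+1 if p = 2
    and r >= 3; the higher terms need only r >= 2. So [v] is 1 mod p. *)
Lemma scalar_arith p r : prime p -> (p = 2 /\ 3 <= r)%N \/ (odd p /\ 2 <= r)%N ->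
  exists v, ((p ^ r.-1).+1 ^ p = (p ^ r * v).+1)%N /\ v%:R != 0 :> 'F_p.
Proof.
move=> p_pr hr; have r2 : (2 <= r)%N by case: hr => -[]; lia.
have [w E] := expnD1_trunc (p ^ r.-1) p.
have [c Ec] : exists c, ('C(p, 2) * (p ^ r.-1) ^ 2 = p ^ r * (p * c))%N.
  case: hr => [[-> r3]|[op _]].
    exists (2 ^ (r - 3))%N; rewrite binn mul1n -expnM -expnS -expnD.
    by congr (_ ^ _)%N; lia.
  have /dvdnP[d ->] : (p %| 'C(p, 2))%N.
    by apply: prime_dvd_bin => //; have := odd_prime_gt2 op p_pr; lia.
  exists (d * p ^ (r - 2))%N; rewrite -expnM.
  have -> : (r.-1 * 2 = r + (r - 2))%N by lia.
  by rewrite expnD; ring.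
have [d Ed] : exists d, (w * (p ^ r.-1) ^ 3 = p ^ r * (p * d))%N.
  exists (w * p ^ (r.-1 * 3 - r.+1))%N.
  have -> : ((p ^ r.-1) ^ 3 = p ^ r * p * p ^ (r.-1 * 3 - r.+1))%N.
    by rewrite -expnM -expnSr -expnD; congr (_ ^ _)%N; lia.
  ring.
exists (1 + p * c + p * d)%N; split.
  by rewrite E Ec Ed -expnS prednK; [ring | lia].
by rewrite !natrD !natrM pchar_Fp_0 // !mul0r !addr0 oner_eq0.
Qed.

Section Main.
Variables (p r n' : nat).
Hypothesis p_pr : prime p.
Hypothesis r_ge2 : (2 <= r)%N.
Local Notation n := n'.+1.
Local Notation P := (p ^ r)%N.
Local Notation N := 'rV['Z_P]_n.

Let r_gt0 : (0 < r)%N. Proof. exact: ltnW. Qed.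
Let p_gt0 : (0 < p)%N. Proof. exact: prime_gt0. Qed.

(* The exponents of the monomial y_0^(k_0) ... y_n'^(k_n'), with
   k_i = (p - 1) p^(n' - i), except that one factor y_n' is left out. *)
Definition slant_exp t := if (t < n')%N then (p.-1 * p ^ (n' - t))%N else p.-2.

(** A basis of p^(r-1) K. As 2(r-1) >= r, the scalar 1 + p^(r-1) fixes it, so slants along it stay
    invariant under the scalar lift. *)
Definition omega_basis t : N := std_basis p r (inord t : 'I_n) *+ p ^ r.-1.

(** The exponents strip p^n - 1 of its base p digits from the top, leaving p^(n-i) - 1 after i
    steps, the shape required by [bin_pred_prime_power]. *)
Lemma sum_slant_exp i : (i <= n')%N ->
  (p ^ (n - i) + \sum_(j < i) slant_exp j = p ^ n)%N.
Proof.
elim: i => [|i IH] i_n; first by rewrite big_ord0 addn0.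
rewrite big_ord_recr /= -[RHS]IH 1?ltnW // /slant_exp i_n subSS.
have -> : (n - i = (n' - i).+1)%N by lia.
have -> : (p ^ (n' - i).+1 = p ^ (n' - i) + p.-1 * p ^ (n' - i))%N.
  by rewrite -mulSn prednK // expnS.
by rewrite addnA addnAC.
Qed.

Lemma coefn_mulrn (x : N) m i : coefn (x *+ m) i = ((coefn x i * m) %% P)%N.
Proof.
elim: m => [|m IH]; first by rewrite mulr0n coefn0 muln0 mod0n.
by rewrite mulrSr coefnD // IH mulnS addnC modnDmr.
Qed.

Lemma mulrn_prime_power (x : N) : x *+ P = 0.
Proof. by rewrite (@mulrn_modn p r n p_pr r_gt0 x _ 0) ?modnn ?mod0n // mulr0n. Qed.

Lemma omega_basisX t : (omega_basis t ^+ p = 1)%g.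
Proof. by rewrite FinRing.zmodXgE -mulrnA -expnSr prednK // mulrn_prime_power. Qed.

Lemma coefn_omega_basis t i :
  coefn (omega_basis t) i = ((i == inord t) * p ^ r.-1)%N.
Proof.
rewrite coefn_mulrn coefn_std_basis // modn_small //.
case: (i == _); rewrite ?mul1n ?mul0n ?expn_gt0 ?p_gt0 //.
by rewrite ltn_exp2l ?prime_gt1 // prednK.
Qed.

Lemma sum_form_omega la t x :
  \sum_(j < p) form_cocycle la x (omega_basis t ^+ j * x)%g
      (omega_basis t ^+ j.+1 * x)%g = la (inord t).
Proof.
rewrite /form_cocycle sum_carry_cocycle //; last first.
  by rewrite -FinRing.zmodXgE omega_basisX.
rewrite (bigD1 (inord t)) //= big1 ?addr0 => [|i it].
  rewrite coefn_omega_basis eqxx mul1n -expnS prednK // divnn expn_gt0 p_gt0 muln1.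
  exact: natr_Zp.
by rewrite coefn_omega_basis (negPf it) mul0n muln0 div0n muln0.
Qed.

Lemma sum_form_basis la x :
  \sum_(j < P) form_cocycle la x (std_basis p r (ord_max : 'I_n) ^+ j * x)%g
      (std_basis p r ord_max ^+ j.+1 * x)%g = la ord_max.
Proof.
rewrite /form_cocycle sum_carry_cocycle ?mulrn_prime_power //.
rewrite (bigD1 ord_max) //= big1 ?addr0 => [|i it].
  rewrite coefn_std_basis // eqxx muln1 divnn expn_gt0 p_gt0 muln1.
  exact: natr_Zp.
by rewrite coefn_std_basis // (negPf it) muln0 div0n muln0.
Qed.

Definition slant_coef : 'F_p :=
  \prod_(i < n) 'C((p ^ n).-1 - \sum_(j < i) slant_exp j, slant_exp i)%:R.

Lemma slant_coef_neq0 : slant_coef != 0.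
Proof.
apply/prodf_neq0 => i _.
have e := sum_slant_exp (leq_ord i).
have pe : (0 < p ^ (n - i))%N by rewrite expn_gt0 p_gt0.
have -> : ((p ^ n).-1 - \sum_(j < i) slant_exp j = (p ^ (n - i)).-1)%N by lia.
rewrite bin_pred_prime_power ?signr_eq0 //.
rewrite subSn ?leq_ord //.
rewrite /slant_exp; case: (ltnP i n') => i_n.
  by rewrite expnS ltn_pmul2r ?expn_gt0 ?p_gt0 // prednK.
have /eqP -> : (n' - i == 0)%N by rewrite subn_eq0.
by rewrite expn1; have := prime_gt1 p_pr; lia.
Qed.

(** The exponents add up to p^n - 2, so a first power of the form cocycle survives, with a monomial
    in [la] as coefficient. *)
Lemma iter_slant_form la l :
  iter_slant p omega_basis slant_exp n (cup2_exp (form_cocycle la) (p ^ n).-1) l =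
  slant_coef * \prod_(i < n) la i ^+ slant_exp i * cup2_exp (form_cocycle la) 1 l.
Proof.
rewrite (@iter_slant_cup2_exp _ _ _ _ _ _ (fun t => la (inord t))).
- rewrite big_split; congr (_ * _); first congr (_ * _).
    by apply: eq_bigr => i _; rewrite inord_val.
  congr (cup2_exp _ _ _).
  have := sum_slant_exp (leqnn n'); rewrite big_ord_recr /= /slant_exp ltnn.
  by rewrite subSnn expn1; have := prime_gt1 p_pr; lia.
- by move=> g x y z; apply: carry_cocycleM.
- by move=> x y; apply: carry_cocycle_normal.
- by move=> g x y; apply: carry_cocycle_sym.
- by move=> i x; apply: sum_form_omega.
Qed.

(** The factor [la ord_max] restores the omitted one, so every exponent is a positive multiple of p
    - 1 and the sum factors over the coordinates into n power sums, each equal to -1. *)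
Lemma sum_form_power :
  \sum_(la : {ffun 'I_n -> 'F_p}) \prod_(i < n) la i ^+ slant_exp i * la ord_max
    = (-1) ^+ n.
Proof.
pose k' i := (p.-1 * p ^ (n' - i))%N.
rewrite -[n in RHS]card_ord -prodr_const.
rewrite (eq_bigr (fun i : 'I_n => \sum_(x : 'F_p) x ^+ k' i)) => [|i _]; last first.
  rewrite sum_Fp_exp ?dvdn_mulr // muln_gt0 expn_gt0 p_gt0 andbT.
  by have := prime_gt1 p_pr; lia.
rewrite bigA_distr_bigA; apply: eq_bigr => la _ /=.
rewrite big_ord_recr [RHS]big_ord_recr /= -mulrA; congr (_ * _).
  by apply: eq_bigr => i _; rewrite /slant_exp /k' /= ltn_ord.
rewrite /slant_exp ltnn /k' subnn muln1 -exprSr; congr (_ ^+ _).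
by have := prime_gt1 p_pr; lia.
Qed.

Lemma iter_slant_dickson_cycle (w : seq N -> 'F_p) :
  (forall g, translate g w =1 w) ->
  \sum_(j < P) iter_slant p omega_basis slant_exp n
     (fun l => dickson_cochain (p ^ n).-1 l - cobd w l)
     [:: 1; std_basis p r (ord_max : 'I_n) ^+ j; std_basis p r ord_max ^+ j.+1]%g
  = slant_coef * (-1) ^+ n.
Proof.
move=> Iw; set a := std_basis p r _.
have C i j : commute (omega_basis i) (omega_basis j).
  by rewrite /commute !FinRing.zmodMgE addrC.
have p0 : p%:R = 0 :> 'F_p by exact: pchar_Fp_0.
under eq_bigr => j _.
  rewrite iter_slantB -(cobd_iter_slant _ omega_basisX C p0) //.
  rewrite (iter_slant_sum _ _ _ _ (fun la => cup2_exp (form_cocycle la) _)).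
  over.
(* The slanted coboundary is again a coboundary of an invariant cochain, so it vanishes on the cycle
   of [a]. *)
rewrite sumrB [X in _ - X]sum_cobd_cycle; first last.
- by apply: translate_iter_slant => // i; rewrite /commute !FinRing.zmodMgE addrC.
- by rewrite natrX p0 expr0n eqn0Ngt r_gt0.
- by rewrite FinRing.zmodXgE mulrn_prime_power.
rewrite subr0 exchange_big -sum_form_power mulr_sumr; apply: eq_bigr => la _ /=.
rewrite -(sum_form_basis la 1%g) !mulr_sumr; apply: eq_bigr => j _.
by rewrite iter_slant_form /= !mulg1 mulr1 mulrA.
Qed.

Lemma not_collapse v : ((p ^ r.-1).+1 ^ p = (P * v).+1)%N -> v%:R != 0 :> 'F_p ->
  ~ lhs_collapses_at_E2 'F_p (hol_extension N).
Proof.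
move=> uv v0 col.
set u := (p ^ r.-1).+1 in uv.
have up : u ^ p = 1 %[mod P] by rewrite uv -addn1 mulnC modnMDl.
(* The extension result concerns degree m + 1, so the degree 2(p^n - 1) has to be a successor. *)
have m_gt0 : (0 < (p ^ n).-1.*2)%N.
  have : (1 < p ^ n)%N by rewrite -(exp1n n) ltn_exp2r // prime_gt1.
  lia.
have [Z [w [IZ cZ Iw Zw]]] := collapse_extends_hol
  (@translate_dickson p r n (p ^ n).-1)
  (@cobd_dickson p r n p_pr r_gt0 (p ^ n).-1)
  (@translate_dickson_prim p r n (p ^ n).-1)
  (@cobd_dickson_prim p r n p_pr r_gt0 (p ^ n).-1) (p ^ n).-1.*2.-1 col.
have ZN l : Z (map (@hol_in N) l) = dickson_cochain (p ^ n).-1 l - cobd w l.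
  apply/(canRL (addrK _)); rewrite Zw prednK //; case: eqP => // /eqP sl.
  by rewrite /dickson_cochain big1 // => la _; apply: cup2_exp_size.
pose b t := hol_in (omega_basis t).
pose X := iter_slant p b slant_exp n Z.
pose a := hol_in (std_basis p r (ord_max : 'I_n)).
pose s := @scalar_hol p r n u p_pr r_gt0 up.
have inC x y : commute (@hol_in N x) (hol_in y).
  by rewrite /commute -!hol_inM FinRing.zmodMgE addrC.
have be i : (b i ^+ p = 1)%g by rewrite -hol_inX -FinRing.zmodXgE omega_basisX.
have p0 : p%:R = 0 :> 'F_p by exact: pchar_Fp_0.
have cX l : cobd X l = 0.
  rewrite cobd_iter_slant //.
    by rewrite (eq_iter_slant _ _ _ _ cZ) iter_slant0.
  by move=> i j; apply: inC.
have Ia : translate a X =1 X by apply: translate_iter_slant => // i; apply: inC.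
have Is : translate s X =1 X.
  apply: translate_iter_slant => // i; rewrite /commute scalar_hol_in.
  congr (hol_in _ * _)%g; rewrite mulrS -mulrnA -expnD.
  rewrite (@mulrn_modn p r n p_pr r_gt0 _ _ 0) ?mulr0n ?addr0 // mod0n.
  by apply/eqP; apply: dvdn_exp2l; lia.
have sa : (s * a = a ^+ u * s)%g by rewrite scalar_hol_in hol_inX.
have aP : (a ^+ P = 1)%g by rewrite -hol_inX mulrn_prime_power.
have u1 : u%:R = 1 :> 'F_p.
  by rewrite /u mulrS natrX p0 expr0n (_ : r.-1 == 0 = false)%N ?addr0 //; lia.
(* The scalar lift forces the sum of [X] over the cycle of [a] to vanish; the slant computation on K
   makes the same sum a nonzero constant. *)
have := cocycle_restriction_eq0 cX p_pr Ia Is sa (scalar_holX _ _ _ _) aP u1 uv v0.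
under eq_bigr => j _.
  rewrite -!hol_inX.
  rewrite -[X _]/(iter_slant p b slant_exp n Z (map (@hol_in N)
    [:: 1; std_basis p r (ord_max : 'I_n) ^+ j; std_basis p r ord_max ^+ j.+1]%g)).
  rewrite -iter_slant_comp; last exact: hol_inM.
  rewrite (eq_iter_slant _ _ _ _ ZN).
  over.
rewrite iter_slant_dickson_cycle // => /eqP.
by rewrite mulf_eq0 signr_eq0 (negPf slant_coef_neq0).
Qed.

End Main.

Local Close Scope ring_scope.

Theorem theorem4p2p2 (p n r : nat) (p_pr : prime p) (n_gt0 : 0 < n)
    (hr : (p = 2 /\ 3 <= r) \/ (odd p /\ 2 <= r)) :
  ~ lhs_collapses_at_E2 'F_p (hol_extension 'rV['Z_(p ^ r)]_n).
Proof.
have [v [uv v0]] := scalar_arith p_pr hr.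
have r_ge2 : (2 <= r)%N by case: hr => -[] _ // /ltnW.
case: n n_gt0 => // n' _.
exact: (not_collapse p_pr r_ge2 uv v0).
Qed.
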